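(* Let $(\mathbb P,\mathbb Q)$ be an admissible pair of shift-invariant probability measures on $\Omega$. Then the following hold. (i) The sequence $(-\tfrac1n\ln\mathbb Q_n)_{n\in\mathbb N}$ on $(\Omega,\mathbb P)$, i.e. the sequence of random variables $x\mapsto-\tfrac1n\ln\mathbb Q_n(x_1^n)$, satisfies the LDP with a convex rate function $I_{\mathbb Q}:\mathbb R\to[0,\infty]$ satisfying $I_{\mathbb Q}(s)=\infty$ for all $s<0$. (ii) The limit $$q_{\mathbb Q}(\alpha):=\lim_{n\to\infty}\frac1n\ln\sum_{u\in\operatorname{supp}\mathbb P_n}\mathbb Q_n(u)^{-\alpha}\mathbb P_n(u)$$ exists in $(-\infty,\infty]$ for all $\alpha\in\mathbb R$ and defines a nondecreasing, convex, lower semicontinuous function $q_{\mathbb Q}:\mathbb R\to(-\infty,\infty]$ satisfying $q_{\mathbb Q}(0)=0$. Moreover, $q_{\mathbb Q}=I_{\mathbb Q}^*$ and $I_{\mathbb Q}=q_{\mathbb Q}^*$. (iii) Assume now that $\mathbb Q=\mathbb P$, and write $I_{\mathbb P},q_{\mathbb P}$ for the corresponding functions. Then, in addition: (a) The sequence $(-\tfrac1n\ln\mathbb P_n)_{n\in\mathbb N}$ on $(\Omega,\mathbb P)$ is exponentially tight, and $I_{\mathbb P}$ is a good rate function satisfying $I_{\mathbb P}(s)\in[s-h_{\mathrm{top}}(\operatorname{supp}\mathbb P),\,s]$ if $s\in[-\gamma_+,-\gamma_-]$ and $I_{\mathbb P}(s)=\infty$ otherwise, where $[-\gamma_+,-\gamma_-]$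 is understood to be $[-\gamma_+,\infty)$ if $\gamma_-=-\infty$. (b) The limit superior (resp. inferior) defining $\gamma_+$ (resp. $\gamma_-$) is actually a limit. (c) For every $\alpha\le1$, $q_{\mathbb P}(\alpha)\le q_{\mathbb P}(1)=h_{\mathrm{top}}(\operatorname{supp}\mathbb P)$. (d) Either $\gamma_->-\infty$ and $q_{\mathbb P}(\alpha)<\infty$ for all $\alpha\in\mathbb R$, or $\gamma_-=-\infty$ and $q_{\mathbb P}(\alpha)=\infty$ for all $\alpha>1$.
   Context: Setting. $\mathbb N=\{1,2,\dots\}$, $\mathcal A$ is a finite alphabet, $\Omega=\mathcal A^{\mathbb N}$ with the product topology and Borel $\sigma$-algebra, $T:\Omega\to\Omega$, $(Tx)_n=x_{n+1}$. For $x\in\Omega$, $x_k^n$ is the word $x_kx_{k+1}\cdots x_n$. For $u\in\mathcal A^n$, $[u]=\{x\in\Omega:x_1^n=u\}$. $\mathcal A^0$ contains only the empty word. $\mathcal P_{\mathrm{inv}}(\Omega)$ is the set of shift-invariant Borel probability measures. For $\mathbb P\in\mathcal P_{\mathrm{inv}}(\Omega)$: $\mathbb P_n(u)=\mathbb P([u])$ for $u\in\mathcal A^n$, $\operatorname{supp}\mathbb P_n=\{u\in\mathcal A^n:\mathbb P_n(u)>0\}$, $\operatorname{supp}\mathbb P=\{x\in\Omega:\mathbb P_n(x_1^n)>0\text{ for all }n\}$, and $h_{\mathrm{top}}(\operatorname{supp}\mathbb P)=\lim_{n}\frac1n\ln|\operatorname{supp}\mathbb P_n|$. $\mathbb P_n\ll\mathbb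 Q_n$ means absolute continuity. Decoupling. Fix sequences $(\tau_n)_{n\in\mathbb N}$ in $\mathbb N\cup\{0\}$ and $(C_n)_{n\in\mathbb N}$ in $[1,\infty)$ with $\lim_n\tau_n/n=\lim_n(\ln C_n)/n=0$. - $\mathbb P\in\mathcal P_{\mathrm{inv}}(\Omega)$ satisfies UD if for all $n,m\in\mathbb N$, $u\in\mathcal A^n$, $v\in\mathcal A^m$, $\xi\in\mathcal A^{\tau_n}$: $\mathbb P_{n+\tau_n+m}(u\xi v)\le C_n\mathbb P_n(u)\mathbb P_m(v)$. - A pair $(\mathbb P,\mathbb Q)$ in $\mathcal P_{\mathrm{inv}}(\Omega)$ satisfies JSLD if for all $n,m\in\mathbb N$, $u\in\mathcal A^n$, $v\in\mathcal A^m$ there exist $0\le\ell\le\tau_n$ and $\xi\in\mathcal A^\ell$ such that both $\mathbb P_{n+\ell+m}(u\xi v)\ge C_n^{-1}\mathbb P_n(u)\mathbb P_m(v)$ and $\mathbb Q_{n+\ell+m}(u\xi v)\ge C_n^{-1}\mathbb Q_n(u)\mathbb Q_m(v)$. - $(\mathbb P,\mathbb Q)$ is admissible if $\mathbb P_n\ll\mathbb Q_n$ for all $n$, $\mathbb P$ and $\mathbb Q$ both satisfy UD, and $(\mathbb P,\mathbb Q)$ satisfies JSLD. Numbers. $\gamma_+=\limsup_n\frac1n\sup_{u\in\mathcal A^n}\ln\mathbb P_n(u)$, $\gamma_-=\liminf_n\frac1n\inf_{u\in\operatorname{supp}\mathbb P_n}\ln\mathbb P_n(u)$. Large deviations. A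 sequence $(Z_n)$ of a.s. finite real random variables on a probability space with measure $\mathbb P_*$ satisfies the LDP with rate function $I$ if $I:\mathbb R\to[0,\infty]$ is lower semicontinuous, $\liminf_n\frac1n\ln\mathbb P_*\{Z_n\in O\}\ge-\inf_OI$ for every open $O\subseteq\mathbb R$, and $\limsup_n\frac1n\ln\mathbb P_*\{Z_n\in\Gamma\}\le-\inf_\Gamma I$ for every closed $\Gamma\subseteq\mathbb R$. $I$ is good if $I(s)\to\infty$ as $s\to\pm\infty$. $(Z_n)$ is exponentially tight if for every $\beta\in\mathbb R$ there is $M>0$ with $\mathbb P_*\{Z_n\notin[-M,M]\}\le e^{-\beta n}$ for all large $n$. The Legendre–Fenchel transform is $f^*(\alpha)=\sup_{s\in\mathbb R}(\alpha s-f(s))$. Convention: $\ln0=-\infty$. *)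

(* Defs.v *)
From HB Require Import structures.
From mathcomp Require Import all_boot all_order all_algebra.
From mathcomp Require Import all_classical all_reals all_analysis.
From mathcomp Require Import measurable_realfun.

Set Implicit Arguments.
Unset Strict Implicit.
Unset Printing Implicit Defensive.

Import Order.TTheory GRing.Theory Num.Theory.
Import numFieldNormedType.Exports.

Local Open Scope classical_set_scope.
Local Open Scope ring_scope.

(* A nonempty alphabet: [measurableType] requires a distinguished point. There
   is no probability measure on the sequences over an empty alphabet. *)
#[short(type="finPointedType")]
HB.structure Definition FinPointed := {A of Finite A & Pointed A}.

(* One-sided sequences, with the Borel sigma-algebra of the product of the
   discrete topologies. The letter written x_k with k >= 1 is [x k.-1]. *)
Definition full_shift (A : finPointedType) : Type :=
  g_sigma_algebraType
    (@open (prod_topology (fun _ : nat => discrete_topology A))).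

Section shift_space.
Context {R : realType} {A : finPointedType}.
Implicit Types (P Q : probability (full_shift A) R) (n m : nat).

Definition shift (x : full_shift A) : full_shift A := fun k => x k.+1.

Definition prefix n (x : full_shift A) : n.-tuple A := [tuple (x i : A) | i < n].

Definition cylinder n (u : n.-tuple A) : set (full_shift A) :=
  [set x | prefix n x = u].

Definition shift_invariant P :=
  forall B : set (full_shift A), measurable B -> P (shift @^-1` B) = P B.

Definition word_prob P n (u : n.-tuple A) : R := fine (P (cylinder u)).

Definition word_supp P n : {set n.-tuple A} :=
  [set u : n.-tuple A | 0 < word_prob P u]%SET.

(* Topological entropy of the support of [P]. For shift-invariant [P] the limit
   exists, since |supp P_(n+m)| <= |supp P_n| |supp P_m|. *)
Definition htop_supp P : R :=
  limn (fun n => n%:R^-1 * ln (#|word_supp P n|%:R : R)).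

(* P_n << Q_n as measures on the finite set of words of length n. *)
Definition word_abs_cont P Q n :=
  forall E : {set n.-tuple A},
    \sum_(u in E) word_prob Q u = 0 -> \sum_(u in E) word_prob P u = 0.

(* Only the terms of index n >= 1 of [tau] and [C] matter. *)
Definition decoupling_rates (tau : nat -> nat) (C : nat -> R) :=
  [/\ forall n, (0 < n)%N -> 1 <= C n,
      (fun n => (tau n)%:R / n%:R : R) @ \oo --> (0 : R) &
      (fun n => ln (C n) / n%:R) @ \oo --> (0 : R)].

Definition UD (tau : nat -> nat) (C : nat -> R) P :=
  forall n m, (0 < n)%N -> (0 < m)%N ->
  forall (u : n.-tuple A) (v : m.-tuple A) (xi : (tau n).-tuple A),
    word_prob P [tuple of u ++ xi ++ v] <= C n * word_prob P u * word_prob P v.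

Definition JSLD (tau : nat -> nat) (C : nat -> R) P Q :=
  forall n m, (0 < n)%N -> (0 < m)%N ->
  forall (u : n.-tuple A) (v : m.-tuple A),
  exists (l : nat) (xi : l.-tuple A),
    [/\ (l <= tau n)%N,
        (C n)^-1 * word_prob P u * word_prob P v
          <= word_prob P [tuple of u ++ xi ++ v] &
        (C n)^-1 * word_prob Q u * word_prob Q v
          <= word_prob Q [tuple of u ++ xi ++ v]].

Definition admissible (tau : nat -> nat) (C : nat -> R) P Q :=
  [/\ forall n, (0 < n)%N -> word_abs_cont P Q n,
      UD tau C P, UD tau C Q & JSLD tau C P Q].

(* [lne 0 = -oo], so this is +oo at the sequences whose n-prefix is Q-null. *)
Definition log_prob Q n (x : full_shift A) : \bar R :=
  (- (n%:R^-1%:E * lne (word_prob Q (prefix n x))%:E))%E.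

Definition gamma_plus_seq P n : \bar R :=
  (n%:R^-1%:E *
    ereal_sup [set lne (word_prob P u)%:E | u in [set: n.-tuple A]])%E.

Definition gamma_minus_seq P n : \bar R :=
  (n%:R^-1%:E *
    ereal_inf [set lne (word_prob P u)%:E | u in [set` word_supp P n]])%E.

Definition gamma_plus P : \bar R := limn_esup (gamma_plus_seq P).

Definition gamma_minus P : \bar R := limn_einf (gamma_minus_seq P).

Definition pressure_seq P Q (alpha : R) n : \bar R :=
  (n%:R^-1%:E *
    lne (\sum_(u in word_supp P n)
           (word_prob Q u `^ (- alpha) * word_prob P u)%R)%:E)%E.

Definition pressure P Q (alpha : R) : \bar R := limn (pressure_seq P Q alpha).

End shift_space.

Section large_deviations.
Context {R : realType}.
Local Open Scope ereal_scope.

(* The library's [convex_function] is for real-valued functions. This one is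
   meant for functions that do not take the value -oo. *)
Definition ereal_convex (f : R -> \bar R) :=
  forall t x y : R, (0 < t < 1)%R ->
    f (t * x + (1 - t) * y)%R <= t%:E * f x + (1 - t)%R%:E * f y.

Definition legendre (f : R -> \bar R) (alpha : R) : \bar R :=
  ereal_sup [set (alpha * s)%R%:E - f s | s in [set: R]].

Definition rate_function (I : R -> \bar R) :=
  (forall s, 0 <= I s) /\ lower_semicontinuous I.

Definition good (I : R -> \bar R) :=
  I s @[s --> +oo%R] --> +oo /\ I s @[s --> -oo%R] --> +oo.

Definition ldp d (T : measurableType d) (P : probability T R)
    (Z : nat -> T -> \bar R) (I : R -> \bar R) :=
  [/\ forall n, (0 < n)%N ->
        measurable_fun [set: T] (Z n) /\ {ae P, forall x, Z n x \is a fin_num},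
      rate_function I,
      forall O : set R, open O ->
        - ereal_inf (I @` O) <=
        limn_einf (fun n => n%:R^-1%:E * lne (P (Z n @^-1` (EFin @` O)))) &
      forall F : set R, closed F ->
        limn_esup (fun n => n%:R^-1%:E * lne (P (Z n @^-1` (EFin @` F)))) <=
        - ereal_inf (I @` F)].

Definition exponentially_tight d (T : measurableType d) (P : probability T R)
    (Z : nat -> T -> \bar R) :=
  forall beta : R, exists2 M : R, (0 < M)%R &
    \forall n \near \oo,
      P [set x | ~ (- M%:E <= Z n x <= M%:E)] <= (expR (- beta * n%:R))%:E.

End large_deviations.

(* Main.v *)
From HB Require Import structures.
From mathcomp Require Import all_boot all_order all_algebra.
From mathcomp Require Import all_classical all_reals all_analysis.
From mathcomp Require Import measurable_realfun.
From mathcomp Require Import ring lra zify.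
Require Import Defs.

Set Implicit Arguments.
Unset Strict Implicit.
Unset Printing Implicit Defensive.

Import Order.TTheory GRing.Theory Num.Theory.
Import numFieldNormedType.Exports.

Local Open Scope classical_set_scope.
Local Open Scope ring_scope.

(** An admissible pair makes the information [info w = - ln Q(w)] of a word
    almost additive: any two words of positive [P]-probability can be joined by
    a connecting word of sublinear length so that the information of the result
    is the sum of the two up to a sublinear error, and its [P]-probability is at
    least the product of the two up to a subexponential factor
    ([decoupled_glued]). Hence behaviour seen at one length [n] reproduces
    itself at all large lengths [N] by joining [N / n] blocks ([mass_blocks]).
    Different sequences of blocks may give the same word, but the lengths of the
    connecting words tell them apart, and with connecting words of length at
    most [e n] there are [(e n + 1) ^ (N / n)] choices of these lengths, whose
    exponential rate vanishes as [n] grows.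

    The rate function is defined by its sublevel sets: [rate_le x r] holds when
    the probability that [info / N] is near [x] is at least [exp (- N r)], up to a
    subexponential factor, along all large [N]. The lower bound of the large
    deviation principle is then immediate, and joining two words of different
    types gives convexity ([rate_le_convex]). For the upper bound, self-reproduction
    turns mass seen at infinitely many lengths into mass at all large lengths
    ([rate_le_frequent]), and a compactness argument at one fixed length [n]
    yields the main tool, [rate_le_mass]: if the sum of [exp (al * info) * P]
    over the words of length [n] with [info] in a given window is at least
    [exp L], there is a point [x] of that window, rescaled by [n], at which the
    rate is at most [al * x - L / n], up to errors that vanish as [n] grows. At one
    length there are finitely many words, so that no tightness is needed,
    although [info / n] need not be bounded as [n] grows. With [al = 0] this
    bounds the probabilities of half-lines, hence, by convexity, of all closed sets
    ([event_closed]); with arbitrary [al] and all words it bounds the pressure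
    by the Legendre transform of the rate ([partition_sum_cvg]), also where it is
    infinite. The rate is nonnegative, convex and lower semicontinuous, and
    therefore is the Legendre transform of the pressure ([legendreK]).

    When [Q = P], a word [w] has probability [exp (- info w)], and joining copies
    of it shows that the rate at [info w / n] is at most [info w / n], up to
    vanishing errors. By convexity the rate is below the identity between the
    extreme values of [info / n] ([rate_le_range]), which also shows that these
    extreme values converge. The pressure at 1 counts the words of
    positive probability, hence is the topological entropy, and duality gives
    the lower bound on the rate. *)

(** * Words and sums over words *)

Section words.
Context {A : finType}.

(** Words are untyped lists and lengths are recorded by membership, so that
    words of different lengths can be glued, cut and collected in one sum
    without casts. *)
Fixpoint words n : seq (seq A) :=
  if n is m.+1 then [seq a :: s | a <- enum A, s <- words m] else [:: [::]].

Lemma mem_words n s : (s \in words n) = (size s == n).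
Proof.
elim: n s => [|n IH] [|a s] //=.
  by apply/negbTE/negP => /allpairsP[[b t] []].
rewrite eqSS -IH; apply/allpairsP/idP => [[[b t] /= [_ tn [_ ->]]] //|sn].
by exists (a, s); rewrite mem_enum.
Qed.

Lemma words_uniq n : uniq (words n).
Proof.
elim: n => //= n IH; apply: allpairs_uniq => //; first exact: enum_uniq.
by move=> [a s] [b t] _ _ /= [-> ->].
Qed.

Definition words_in l1 l2 := flatten [seq words l | l <- index_iota l1 l2.+1].

Lemma mem_words_in l1 l2 s : (s \in words_in l1 l2) = (l1 <= size s <= l2)%N.
Proof.
apply/flatten_mapP/idP => [[l]|sl].
  by rewrite mem_index_iota mem_words => + /eqP ->.
by exists (size s); rewrite ?mem_words// mem_index_iota.
Qed.

Lemma words_in_uniq l1 l2 : uniq (words_in l1 l2).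
Proof.
rewrite /words_in; have : uniq (index_iota l1 l2.+1) by exact: iota_uniq.
elim: (index_iota _ _) => //= l r IH /andP[lr /IH ur]; rewrite cat_uniq words_uniq ur andbT /=.
apply/hasPn => s /flatten_mapP[k kr]; rewrite !mem_words => /eqP ->.
by apply: contraNneq lr => <-.
Qed.

Lemma words_inn n : words_in n n = words n.
Proof. by rewrite /words_in /index_iota subSnn /= cats0. Qed.

End words.

Section seq_sums.
Context {R : realType}.

Lemma ler_sum_sub (T : eqType) (r1 r2 : seq T) (g : T -> R) :
  uniq r1 -> {subset r1 <= r2} -> uniq r2 -> (forall y, 0 <= g y) ->
  \sum_(y <- r1) g y <= \sum_(y <- r2) g y.
Proof.
move=> u1 r12 u2 g0.
rewrite [leRHS](bigID (mem r1)) /= -[X in _ <= X + _]big_filter.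
have pr : perm_eq [seq y <- r2 | y \in r1] r1.
  apply: uniq_perm (filter_uniq _ u2) u1 _ => y.
  by rewrite mem_filter; case: (boolP (y \in r1)) => //= /r12 ->.
rewrite (perm_big _ pr) /=.
by rewrite lerDl sumr_ge0.
Qed.

(** The labels [(h x).2] tell apart the points of a fibre of [fun x => (h
    x).1], so that no fibre has more than [m] points. *)
Lemma ler_sum_fibers (T1 T2 : eqType) (r1 : seq T1) (r2 : seq T2) (m : nat)
    (h : T1 -> T2 * nat) (f : T1 -> R) (g : T2 -> R) :
  uniq r1 -> uniq r2 -> {in r1 &, injective h} -> (forall y, 0 <= g y) ->
  (forall x, x \in r1 ->
    [/\ (h x).1 \in r2, ((h x).2 < m)%N & f x <= g (h x).1]) ->
  \sum_(x <- r1) f x <= m%:R * \sum_(y <- r2) g y.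
Proof.
move=> u1 u2 inj g0 hP.
have -> : m%:R * \sum_(y <- r2) g y
    = \sum_(z <- [seq (y, j) | y <- r2, j <- iota 0 m]) g z.1.
  rewrite big_allpairs mulr_sumr; apply: eq_bigr => y _ /=.
  by rewrite big_const_seq count_predT size_iota iter_addr_0 mulr_natl.
apply: (@le_trans _ _ (\sum_(z <- map h r1) g z.1)).
  rewrite big_map [leLHS]big_seq [leRHS]big_seq.
  by apply: ler_sum => x /hP[].
apply: (@ler_sum_sub _ _ _ (fun z => g z.1)) => //.
- by rewrite map_inj_in_uniq.
- move=> z /mapP[x /hP[h1 h2 _] ->]; apply/allpairsP.
  by exists (h x); rewrite mem_iota h1 h2; split => //; case: (h x).
- apply: allpairs_uniq => //; first exact: iota_uniq.
  by move=> [? ?] [? ?] _ _ /= [-> ->].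
Qed.

End seq_sums.

(** * Sublinear sequences *)

Section sublinear.
Context {R : realType}.
Implicit Types (e f : nat -> R).

(** The constant [B] absorbs finitely many terms, in particular the term of
    index 0, about which the convergence of [e n / n] says nothing. *)
Definition sublinear e :=
  forall eps : R, 0 < eps -> exists B : R, forall n, e n <= eps * n%:R + B.

Lemma sublinearD e f : sublinear e -> sublinear f ->
  sublinear (fun n => e n + f n).
Proof.
move=> He Hf eps e0.
have [B1 H1] := He (eps / 2) ltac:(by rewrite divr_gt0).
have [B2 H2] := Hf (eps / 2) ltac:(by rewrite divr_gt0).
exists (B1 + B2) => n.
by have := H1 n; have := H2 n; rewrite mulrAC (_ : eps * _ / 2 = (eps * n%:R) / 2)//; lra.
Qed.

Lemma sublinearZ (c : nat) e : sublinear e -> sublinear (fun n => c%:R * e n).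
Proof.
move=> He; elim: c => [|c IH].
  by move=> eps e0; exists 0 => n; rewrite mul0r addr0 mulr_ge0// ltW.
move=> eps /(sublinearD IH He) [B HB].
by exists B => n; rewrite -natr1 mulrDl mul1r.
Qed.

Lemma sublinear_cst (c : R) : sublinear (fun=> c).
Proof. by move=> eps e0; exists c => n; rewrite lerDr mulr_ge0// ltW. Qed.

Lemma sublinear_le e f : (forall n, e n <= f n) -> sublinear f -> sublinear e.
Proof.
move=> ef Hf eps e0; have [B HB] := Hf eps e0.
by exists B => n; apply: le_trans (ef n) (HB n).
Qed.

Lemma cvg_sublinear e : (fun n => e n / n%:R) @ \oo --> (0 : R) -> sublinear e.
Proof.
move=> /cvgrPdist_le He eps e0.
have [N _ HN] := He eps e0.
exists (\sum_(i < N.+1) `|e i|) => n.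
have [nN|Nn] := leqP n N.
  have nN1 : (n < N.+1)%N by [].
  rewrite (bigD1 (Ordinal nN1)) //= addrA.
  have : 0 <= \sum_(i < N.+1 | i != Ordinal nN1) `|e i| by apply: sumr_ge0.
  have := ler_norm (e n); have : 0 <= eps * n%:R by rewrite mulr_ge0// ltW.
  by lra.
have n0 : 0 < n%:R :> R by rewrite ltr0n; lia.
have /= := HN n (ltnW Nn); rewrite sub0r normrN => He1.
have := le_trans (ler_norm _) He1; rewrite ler_pdivrMr// => H.
by apply: (le_trans H); rewrite lerDl sumr_ge0.
Qed.

Lemma sublinear_near e : sublinear e -> forall eps : R, 0 < eps ->
  \forall n \near \oo, e n <= eps * n%:R.
Proof.
move=> He eps e0.
have [B HB] := He (eps / 2) ltac:(by rewrite divr_gt0).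
near=> n.
have : B <= eps / 2 * n%:R.
  rewrite -ler_pdivrMl ?divr_gt0//; near: n; exact: nbhs_infty_ger.
by have := HB n; lra.
Unshelve. all: by end_near. Qed.

End sublinear.

(** * Gluing words *)

Section word_weights.
Context {R : realType} {A : finType}.
Implicit Types (p q : seq A -> R) (s t u v w : seq A).

(** The two sums express that the cylinder probabilities are consistent and,
    for the extension to the left, that the measure is shift-invariant. *)
Definition word_weight p :=
  [/\ p [::] = 1, forall s, 0 <= p s,
      forall s, \sum_a p (rcons s a) = p s &
      forall s, \sum_a p (a :: s) = p s].

Lemma weight_catl p s t : word_weight p -> p (s ++ t) <= p s.
Proof.
move=> [_ p0 pr _]; elim/last_ind: t => [|t a IH]; first by rewrite cats0.
rewrite -rcons_cat (le_trans _ IH)// -[leRHS]pr (bigD1 a)//= lerDl.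
by apply: sumr_ge0.
Qed.

Lemma weight_catr p s t : word_weight p -> p (s ++ t) <= p t.
Proof.
move=> [_ p0 _ pl]; elim: s => [|a s IH] //=.
by rewrite (le_trans _ IH)// -[leRHS]pl (bigD1 a)//= lerDl sumr_ge0.
Qed.

Lemma weight_le1 p s : word_weight p -> p s <= 1.
Proof.
by move=> wp; have [<- _ _ _] := wp; have := weight_catl [::] s wp.
Qed.

Lemma weight_words p n : word_weight p -> \sum_(s <- words n) p s = 1.
Proof.
move=> [p1 _ _ pl]; elim: n => [|n IH] /=; first by rewrite big_seq1.
rewrite big_allpairs_dep exchange_big /= -[RHS]IH.
by apply: eq_bigr => s _; rewrite big_enum/= pl.
Qed.

Record decoupled_words (tau : nat -> nat) (C : nat -> R) p q := DecoupledWords {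
  decoupled_weightl : word_weight p;
  decoupled_weightr : word_weight q;
  decoupled_gt0 : forall s, 0 < p s -> 0 < q s;
  decoupled_ge1 : forall n, (0 < n)%N -> 1 <= C n;
  decoupled_tau : sublinear (fun n => (tau n)%:R : R);
  decoupled_C : sublinear (fun n => ln (C n));
  decoupled_upper : forall u x v, (0 < size u)%N -> size x = tau (size u) ->
    (0 < size v)%N -> q (u ++ x ++ v) <= C (size u) * (q u * q v);
  decoupled_lower : forall u v, (0 < size u)%N -> (0 < size v)%N ->
    exists x, [/\ (size x <= tau (size u))%N,
      (C (size u))^-1 * (p u * p v) <= p (u ++ x ++ v) &
      (C (size u))^-1 * (q u * q v) <= q (u ++ x ++ v)] }.

(** What decoupling is used for. Between two words there is a connecting word
    of sublinear length such that [q] is multiplicative from both sides and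
    [p] from below, up to a subexponential factor; [glued_long] supplies the
    words with which a word is extended to a prescribed length. *)
Record glued_words (c : nat) (e : nat -> nat) p q := GluedWords {
  glued_weightl : word_weight p;
  glued_weightr : word_weight q;
  glued_gt0 : forall s, 0 < p s -> 0 < q s;
  glued_sublinear : sublinear (fun n => (e n)%:R : R);
  glued_long : forall K, (0 < K)%N -> exists w, [/\ (K <= size w)%N,
    expR (- (c * K)%:R) <= p w & expR (- (c * K)%:R) <= q w];
  glued_glue : forall u v, (0 < size u)%N -> (0 < size v)%N ->
    exists x, [/\ (size x <= e (size u))%N,
      expR (- (e (size u))%:R) * (p u * p v) <= p (u ++ x ++ v),
      expR (- (e (size u))%:R) * (q u * q v) <= q (u ++ x ++ v) &
      q (u ++ x ++ v) <= expR (e (size u))%:R * (q u * q v)] }.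

Section gluing.
Context {tau : nat -> nat} {C : nat -> R} {p q : seq A -> R}.
Context (dec : decoupled_words tau C p q).
Let wp := decoupled_weightl dec.
Let wq := decoupled_weightr dec.

Let p0 s : 0 <= p s. Proof. by case: wp. Qed.
Let q0 s : 0 <= q s. Proof. by case: wq. Qed.

Let C_expR n : (0 < n)%N -> (C n)^-1 = expR (- ln (C n)).
Proof.
move=> n0; have C0 : 0 < C n := lt_le_trans ltr01 (decoupled_ge1 dec n0).
by rewrite expRN lnK.
Qed.

(** Lower decoupling is iterated on a single letter of positive weight: each
    step adds between 1 and [1 + tau 1] letters and costs a constant factor. *)
Lemma long_words : exists c T, forall K, (0 < K)%N -> exists w,
  [/\ (K <= size w <= T * K)%N,
    expR (- (c * K)%:R) <= p w & expR (- (c * K)%:R) <= q w].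
Proof.
have [a pa] : exists a, 0 < p [:: a].
  apply/not_existsP => pa; have [p1 _ _ pl] := wp.
  have := pl [::]; rewrite p1 big1 => [/esym/eqP|a _]; first by rewrite oner_eq0.
  by apply/eqP; rewrite eq_le p0 andbT leNgt; apply/negP.
have qa := decoupled_gt0 dec pa.
have [C1 C10] : {C1 | (C 1%N)^-1 = C1} by exists (C 1%N)^-1.
have C1_gt0 : 0 < C1 by rewrite -C10 C_expR// expR_gt0.
(* cost of one more letter, for [p] and [q] alike *)
pose k0 := C1 * Num.min (p [:: a]) (q [:: a]).
have k0_gt0 : 0 < k0 by rewrite mulr_gt0// lt_min pa.
pose c := (Num.truncn (Num.max 0 (- ln k0))).+1.
have ck0 : expR (- c%:R) <= k0.
  rewrite -[leRHS]lnK ?ler_expR ?posrE// lerNl.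
  have : Num.max 0 (- ln k0) <= c%:R.
    by apply/ltW; rewrite /c truncnS_gt.
  by rewrite ge_max => /andP[].
have ckp : expR (- c%:R) <= C1 * p [:: a].
  by apply: (le_trans ck0); rewrite ler_pM2l// ge_min lexx.
have ckq : expR (- c%:R) <= C1 * q [:: a].
  by apply: (le_trans ck0); rewrite ler_pM2l// ge_min lexx orbT.
have C1_le1 : C1 <= 1.
  by rewrite -C10 C_expR// expR_le1 oppr_le0 ln_ge0// (decoupled_ge1 dec).
exists c, (tau 1).+1; elim=> // -[|K] IH _.
  exists [:: a]; rewrite !muln1; split => //.
    by apply: (le_trans ckp); rewrite ger_pMl.
  by apply: (le_trans ckq); rewrite ger_pMl.
have [w [/andP[w1 w2] pw qw]] := IH isT.
have [x [x1 px qx]] := decoupled_lower dec (u := [:: a]) (v := w) isT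
  (leq_trans (ltn0Sn _) w1).
have eK : expR (- (c * K.+2)%:R) = expR (- c%:R) * expR (- (c * K.+1)%:R) :> R.
  by rewrite -expRD -opprD -natrD -mulnS.
exists ([:: a] ++ x ++ w); split.
- rewrite /= size_cat mulnS; move: x1 w1 w2 => /=.
  by move: ((tau 1).+1 * K.+1)%N => m; clear; lia.
- apply: le_trans px; rewrite eK /= C10 mulrA.
  by apply: ler_pM; rewrite ?expR_ge0.
- apply: le_trans qx; rewrite eK /= C10 mulrA.
  by apply: ler_pM; rewrite ?expR_ge0.
Qed.

(** Upper decoupling holds for gaps of exactly [tau n] letters, whereas lower
    decoupling produces gaps of uncontrolled length at most [tau n]. Between
    the two words a word of [long_words] is inserted that has more than [tau
    n] letters and weight at least [exp (- c (tau n + 1))]. Then the gap is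
    long enough for the upper bound, because the letters in excess only
    decrease the weight, and both lower bounds lose a factor that is
    subexponential in [n]. *)
Lemma decoupled_glued : exists c e, glued_words c e p q.
Proof.
have [c [T long]] := long_words.
have [B1 tauB] := decoupled_tau dec ltr01.
have [B2 CB] := decoupled_C dec ltr01.
(* [tau j] and [ln (C j)] are at most [j + B]; the inserted word has at most
   [T * K n] letters *)
pose B := (Num.truncn (Num.max 0 (Num.max B1 B2))).+1.
have hB : (B1 <= B%:R) /\ (B2 <= B%:R).
  have : Num.max 0 (Num.max B1 B2) <= B%:R by apply/ltW; rewrite /B truncnS_gt.
  by rewrite !ge_max => /and3P[].
pose K n := (tau n).+1.
pose e n := (tau n + (c + T + T + T + B + B) * K n + (Num.truncn (ln (C n))).+1)%N.
exists c, e; split.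
- exact: wp.
- exact: wq.
- exact: decoupled_gt0 dec.
- have sK : sublinear (fun n => (K n)%:R : R).
    apply: sublinear_le (sublinearD (decoupled_tau dec) (sublinear_cst 1)) => n.
    by rewrite -natr1.
  have sC : sublinear (fun n => (Num.truncn (ln (C n))).+1%:R : R).
    (* [ln (C 0)] may be negative, which only affects the constants *)
    move=> eps e0; have [D HD] := decoupled_C dec e0.
    exists (Num.max 0 D + 1) => n.
    rewrite -natr1 addrA lerD2r.
    have [l0|l0] := leP 0 (ln (C n)).
      rewrite (@le_trans _ _ (ln (C n))) ?truncn_le//.
      by rewrite (le_trans (HD n))// lerD2l le_max lexx orbT.
    have -> : Num.truncn (ln (C n)) = 0%N.
      by rewrite truncn_floor leNgt l0.
    by rewrite addr_ge0// ?mulr_ge0// ?(ltW e0)// le_max lexx.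
  have := sublinearD (sublinearD (decoupled_tau dec)
    (sublinearZ (c + T + T + T + B + B) sK)) sC.
  by apply: sublinear_le => n; rewrite -natrM -!natrD.
- by move=> k /long[w [/andP[wk _] pw qw]]; exists w.
move=> u v u0 v0.
set n := size u.
have [w [/andP[w1 w2] pw qw]] := long (K n) isT.
have w0 : (0 < size w)%N by exact: leq_trans w1.
have [y [y1 py qy]] := decoupled_lower dec w0 v0.
have wyv0 : (0 < size (w ++ y ++ v))%N by rewrite size_cat ltn_addr.
have [x [x1 px qx]] := decoupled_lower dec u0 wyv0.
have [B1B B2B] := hB.
have lnCw : ln (C (size w)) <= (T * K n + B)%:R.
  by rewrite natrD (le_trans (CB _))// mul1r lerD// ler_nat.
have tauw : (tau (size w) <= T * K n + B)%N.
  by rewrite -(ler_nat R) natrD (le_trans (tauB _))// mul1r lerD// ler_nat.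
have lnCn : ln (C n) <= (Num.truncn (ln (C n))).+1%:R.
  by apply/ltW; rewrite truncnS_gt.
have BK : (B <= B * K n)%N by rewrite leq_pmulr.
have eE : (e n)%:R = (tau n)%:R + (c * K n)%:R + 3 * (T * K n)%:R
     + 2 * (B * K n)%:R + (Num.truncn (ln (C n))).+1%:R :> R.
  by rewrite /e !mulnDl !natrD; ring.
have BKr : B%:R <= (B * K n)%:R :> R by rewrite ler_nat.
have lower f : (forall s, 0 <= f s) ->
    (C (size w))^-1 * (f w * f v) <= f (w ++ y ++ v) ->
    (C n)^-1 * (f u * f (w ++ y ++ v)) <= f (u ++ x ++ w ++ y ++ v) ->
    expR (- (c * K n)%:R) <= f w ->
    expR (- (e n)%:R) * (f u * f v) <= f (u ++ x ++ w ++ y ++ v).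
  move=> f0 fy fx fw; apply: le_trans fx.
  apply: (@le_trans _ _ ((C n)^-1 * (f u * ((C (size w))^-1 * (f w * f v))))).
    rewrite !C_expR//.
    apply: (@le_trans _ _ (expR (- ln (C n)) * expR (- ln (C (size w)))
        * expR (- (c * K n)%:R) * (f u * f v))); last first.
      rewrite (_ : expR _ * (f u * _) = expR (- ln (C n)) *
         expR (- ln (C (size w))) * f w * (f u * f v)); last by ring.
      by rewrite ler_wpM2r ?mulr_ge0// ler_wpM2l// mulr_ge0// expR_ge0.
    rewrite ler_wpM2r ?mulr_ge0// -!expRD ler_expR eE.
    have : 0 <= (tau n)%:R :> R by [].
    have : 0 <= (T * K n)%:R :> R by [].
    have : 0 <= B%:R :> R by [].
    by move: lnCw; rewrite natrD; lra.
  rewrite C_expR// ler_wpM2l ?expR_ge0//.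
  by rewrite ler_wpM2l.
exists (x ++ w ++ y).
rewrite -!catA; split.
- rewrite !size_cat; move: x1 y1 w2 tauw BK; rewrite /e -/n !mulnDl; clear.
  by move: (c * _)%N (T * _)%N (B * _)%N => *; lia.
- exact: lower.
- exact: lower.
(* the gap is cut into its first [tau n] letters and a rest put in front of [v] *)
rewrite (_ : x ++ w ++ y ++ v = take (tau n) (x ++ w ++ y) ++
    drop (tau n) (x ++ w ++ y) ++ v); last first.
  by rewrite [RHS]catA cat_take_drop -!catA.
have := decoupled_upper dec u0 (x := take (tau n) (x ++ w ++ y))
  (v := drop (tau n) (x ++ w ++ y) ++ v).
rewrite size_takel; last first.
  by rewrite !size_cat; move: w1; rewrite /K; clear; lia.
rewrite size_cat ltn_addl// => /(_ erefl isT)/le_trans; apply.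
rewrite -[C _]invrK C_expR// expRN invrK -/n.
apply: ler_pM; rewrite ?expR_ge0 ?mulr_ge0 ?expR_ge0//.
  rewrite ler_expR eE (le_trans lnCn)// lerDr.
  by rewrite !addr_ge0// mulr_ge0.
by rewrite ler_wpM2l// weight_catr.
Qed.

End gluing.
End word_weights.

(** * Weighted sums over words *)

Section mass.
Context {R : realType} {A : finType} {c : nat} {e : nat -> nat}.
Context {p q : seq A -> R} (glued : glued_words c e p q).
Implicit Types (s t u v w : seq A).
Let wp := glued_weightl glued.
Let wq := glued_weightr glued.

Let p0 s : 0 <= p s. Proof. by case: wp. Qed.
Let q0 s : 0 <= q s. Proof. by case: wq. Qed.

Definition info s : R := - ln (q s).

Lemma info_ge0 s : 0 <= info s.
Proof. by rewrite oppr_ge0 ln_le0// weight_le1. Qed.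

(** A partition function restricted to a window of values of [info]. At a
    single length, [al = 0] gives the probability of the window, and a window
    containing all values gives the sum that defines the pressure. *)
Definition mass (al : R) (l1 l2 : nat) (a b : R) : R :=
  \sum_(s <- words_in l1 l2 | (0 < p s) && (a <= info s <= b))
     expR (al * info s) * p s.

Lemma mass_ge0 al l1 l2 a b : 0 <= mass al l1 l2 a b.
Proof. by apply: sumr_ge0 => s _; rewrite mulr_ge0// expR_ge0. Qed.

Let massE al l1 l2 a b : mass al l1 l2 a b =
  \sum_(s <- [seq s <- words_in l1 l2 | (0 < p s) && (a <= info s <= b)])
     expR (al * info s) * p s.
Proof. by rewrite big_filter. Qed.

Lemma le_mass al l1 l2 l1' l2' a b a' b' :
  (l1' <= l1)%N -> (l2 <= l2')%N -> a' <= a -> b <= b' ->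
  mass al l1 l2 a b <= mass al l1' l2' a' b'.
Proof.
move=> l1l l2l aa bb; rewrite !massE.
apply: (@ler_sum_sub _ _ _ _ (fun s => expR (al * info s) * p s)).
- exact/filter_uniq/words_in_uniq.
- move=> s; rewrite !mem_filter !mem_words_in.
  move=> /andP[/and3P[-> sa sb] /andP[s1 s2]] /=.
  by rewrite (le_trans aa)// (le_trans sb)// (leq_trans l1l)// (leq_trans s2).
- exact/filter_uniq/words_in_uniq.
- by move=> s; rewrite mulr_ge0// expR_ge0.
Qed.

Lemma glue_info n u v : size u = n -> (0 < n)%N -> (0 < size v)%N ->
  0 < p u -> 0 < p v ->
  exists x, [/\ (size x <= e n)%N, 0 < p (u ++ x ++ v),
    `|info (u ++ x ++ v) - (info u + info v)| <= (e n)%:R &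
    expR (- (e n)%:R) * (p u * p v) <= p (u ++ x ++ v)].
Proof.
move=> <- u0 v0 pu pv.
have qu := glued_gt0 glued pu; have qv := glued_gt0 glued pv.
have [x [x1 px qx1 qx2]] := glued_glue glued u0 v0.
have pz : 0 < p (u ++ x ++ v).
  by apply: lt_le_trans px; rewrite !mulr_gt0// expR_gt0.
have qz := glued_gt0 glued pz.
exists x; split => //.
have quv : 0 < q u * q v by rewrite mulr_gt0.
move: qx1; rewrite -ler_ln ?posrE ?mulr_gt0 ?expR_gt0// => h1.
move: qx2; rewrite -ler_ln ?posrE ?mulr_gt0 ?expR_gt0//.
move: h1; rewrite !lnM ?posrE ?mulr_gt0 ?expR_gt0// !expRK /info => h1 h2.
by rewrite ler_norml; apply/andP; split; lra.
Qed.

(** Gluing multiplies masses, up to factors [exp (O (e n))]: the glued word and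
    the length of the connecting word determine the two factors, so that at most
    [e n + 1] pairs give the same word. *)
Lemma mass_glue al n l1 l2 a1 b1 a2 b2 : (0 < n)%N -> (0 < l1)%N ->
  mass al n n a1 b1 * mass al l1 l2 a2 b2 <= expR ((2 + `|al|) * (e n)%:R) *
    mass al (n + l1) (n + e n + l2) (a1 + a2 - (e n)%:R) (b1 + b2 + (e n)%:R).
Proof.
move=> n0 l0; rewrite !massE; set r1 := seq.filter _ _; set r2 := seq.filter _ _.
set r3 := seq.filter _ _; set phi := fun s => expR (al * info s) * p s.
have phi0 s : 0 <= phi s by rewrite mulr_ge0 ?expR_ge0.
have r1P u : u \in r1 -> [/\ size u = n, 0 < p u & a1 <= info u <= b1].
  by rewrite mem_filter words_inn mem_words => /andP[/andP[? ?] /eqP].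
have r2P v : v \in r2 -> [/\ (0 < size v)%N, (l1 <= size v <= l2)%N, 0 < p v &
    a2 <= info v <= b2].
  rewrite mem_filter mem_words_in => /andP[/andP[? ?] /andP[? ?]]; split => //.
    exact: leq_trans l0 _.
  exact/andP.
have glueP (uv : seq A * seq A) : {x | uv.1 \in r1 -> uv.2 \in r2 ->
   [/\ (size x <= e n)%N, 0 < p (uv.1 ++ x ++ uv.2),
    `|info (uv.1 ++ x ++ uv.2) - (info uv.1 + info uv.2)| <= (e n)%:R &
    expR (- (e n)%:R) * (p uv.1 * p uv.2) <= p (uv.1 ++ x ++ uv.2)]}.
  apply: cid; have [/andP[/r1P[u1 u2 _] /r2P[v1 _ v2 _]]|] :=
    boolP ((uv.1 \in r1) && (uv.2 \in r2)).
    by have [x xP] := glue_info u1 n0 v1 u2 v2; exists x.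
  by move=> /negP uv0; exists [::] => h1 h2; exfalso; apply/uv0/andP.
pose x uv := sval (glueP uv).
have xP u v : u \in r1 -> v \in r2 ->
    [/\ (size (x (u, v)) <= e n)%N, 0 < p (u ++ x (u, v) ++ v),
      `|info (u ++ x (u, v) ++ v) - (info u + info v)| <= (e n)%:R &
      expR (- (e n)%:R) * (p u * p v) <= p (u ++ x (u, v) ++ v)].
  by move=> h1 h2; exact: (svalP (glueP (u, v)) h1 h2).
pose h (uv : seq A * seq A) := (uv.1 ++ x uv ++ uv.2, size (x uv)).
have -> : (\sum_(s <- r1) phi s) * (\sum_(s <- r2) phi s) =
    \sum_(uv <- [seq (u, v) | u <- r1, v <- r2]) phi uv.1 * phi uv.2.
  rewrite big_allpairs mulr_suml; apply: eq_bigr => u _ /=.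
  by rewrite mulr_sumr.
have e1 : (e n).+1%:R <= expR (e n)%:R :> R.
  by apply: le_trans (expR_ge1Dx _); rewrite -natr1 addrC.
rewrite (_ : expR _ = expR (e n)%:R * expR ((1 + `|al|) * (e n)%:R)); last first.
  by rewrite -expRD; congr expR; ring.
rewrite -mulrA mulr_sumr.
apply: (@le_trans _ _ ((e n).+1%:R *
   \sum_(s <- r3) (expR ((1 + `|al|) * (e n)%:R) * phi s))); last first.
  by rewrite ler_wpM2r// sumr_ge0// => s _; rewrite mulr_ge0// expR_ge0.
have u1 : uniq r1 by exact/filter_uniq/words_in_uniq.
have u2 : uniq r2 by exact/filter_uniq/words_in_uniq.
apply: (@ler_sum_fibers _ _ _ _ _ _ h (fun uv => phi uv.1 * phi uv.2)
  (fun s => expR ((1 + `|al|) * (e n)%:R) * phi s)).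
- by apply: allpairs_uniq => // -[? ?] [? ?] _ _ /= [-> ->].
- exact/filter_uniq/words_in_uniq.
- move=> _ _ /allpairsP[[u v] /= [ur vr ->]] /allpairsP[[u' v'] /= [ur' vr' ->]].
  move=> [] /eqP + xx.
  have [su _ _] := r1P _ ur; have [su' _ _] := r1P _ ur'.
  by rewrite eqseq_cat ?su ?su'// eqseq_cat// => /and3P[/eqP -> _ /eqP ->].
- by move=> s; rewrite mulr_ge0// expR_ge0.
move=> _ /allpairsP[[u v] /= [ur vr ->]].
have [su pu /andP[ua ub]] := r1P _ ur.
have [sv /andP[lv1 lv2] pv /andP[va vb]] := r2P _ vr.
have [x1 x2 x3 x4] := xP _ _ ur vr.
have [i1 i2] : info u + info v - (e n)%:R <= info (u ++ x (u, v) ++ v) /\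
    info (u ++ x (u, v) ++ v) <= info u + info v + (e n)%:R.
  by move: x3; rewrite ler_norml => /andP[h1 h2]; split; lra.
split => //.
  rewrite mem_filter mem_words_in x2 !size_cat su /=.
  rewrite (le_trans _ i1)/=; last by rewrite lerD2r lerD.
  rewrite (le_trans i2)/=; last by rewrite lerD2r lerD.
  by move: x1 lv1 lv2; clear; lia.
rewrite /phi mulrACA -expRD -mulrDr.
apply: (@le_trans _ _ (expR (al * (info u + info v)) *
    (expR (e n)%:R * p (u ++ x (u, v) ++ v)))).
  rewrite ler_wpM2l ?expR_ge0//.
  by rewrite -ler_pdivrMl ?expR_gt0// -expRN.
rewrite !mulrA -!expRD ler_wpM2r// ler_expR.
suff : al * (info u + info v) <= al * info (u ++ x (u, v) ++ v) + `|al| * (e n)%:R.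
  by lra.
rewrite -lerBlDl -mulrBr (le_trans (ler_norm _))// normrM ler_wpM2l//.
by rewrite distrC.
Qed.

(** The blocks are added on the left, so that every step costs the error [e
    n] of the block length, whatever the length of the word that has already
    been built. *)
Lemma mass_iter al n a b k : (0 < n)%N -> (0 < k)%N ->
  mass al n n a b ^+ k <= expR ((2 + `|al|) * (k%:R * (e n)%:R)) *
    mass al (k * n) (k * (n + e n)) (k%:R * (a - (e n)%:R)) (k%:R * (b + (e n)%:R)).
Proof.
move=> n0; case: k => // k _; elim: k => [|k IH].
  rewrite expr1 !mul1n !mul1r.
  rewrite (@le_trans _ _ (mass al n (n + e n) (a - (e n)%:R) (b + (e n)%:R)))//.
    by apply: le_mass; rewrite ?leq_addr ?gerBl ?lerDl.
  rewrite ler_peMl ?mass_ge0// -expR0 ler_expR mulr_ge0// addr_ge0.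
rewrite exprS (le_trans (ler_wpM2l (mass_ge0 _ _ _ _ _) IH))//.
rewrite mulrCA; set X := expR _.
have kn : (0 < k.+1 * n)%N by rewrite muln_gt0.
rewrite (le_trans (ler_wpM2l (expR_ge0 _) (mass_glue _ _ _ _ _ _ n0 kn)))//.
rewrite [leLHS]mulrA /X -expRD; apply: ler_pM; rewrite ?expR_ge0 ?mass_ge0//.
  by rewrite ler_expR -[k.+2%:R]natr1; lra.
by apply: le_mass; rewrite ?mulSn// -[k.+2%:R]natr1; lra.
Qed.

(** The error [e (size s)] of a long word is paid only once. Cutting the
    extended word at the prescribed length increases its weight, and [s]
    being a prefix bounds it from above. *)
Lemma pad_word s N : (0 < size s)%N -> (size s <= N)%N -> 0 < p s ->
  exists t, [/\ size t = N, take (size s) t = s, 0 < p t,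
    info s <= info t <= info s + (e (size s) + c * (N - size s).+1)%:R &
    expR (- (e (size s) + c * (N - size s).+1)%:R) * p s <= p t].
Proof.
move=> s0 sN ps.
have [w [w1 pw qw]] := glued_long glued (ltn0Sn (N - size s)).
have w0 : (0 < size w)%N by exact: leq_trans w1.
have [x [x1 px qx _]] := glued_glue glued s0 w0.
pose t := take N (s ++ x ++ w).
have st : size t = N.
  by rewrite size_takel// !size_cat; move: w1 sN; clear; lia.
have ts : take (size s) t = s.
  by rewrite take_takel// take_size_cat.
have qs := glued_gt0 glued ps.
have E (f : seq A -> R) : word_weight f -> 0 < f s ->
    expR (- (e (size s))%:R) * (f s * f w) <= f (s ++ x ++ w) ->
    expR (- (c * (N - size s).+1)%:R) <= f w ->
    expR (- (e (size s) + c * (N - size s).+1)%:R) * f s <= f t.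
  move=> wf fs fx fw; rewrite natrD opprD expRD -mulrA.
  apply: (@le_trans _ _ (f (s ++ x ++ w))); last first.
    by rewrite -[s ++ x ++ w](cat_take_drop N) weight_catl.
  by apply: le_trans fx; rewrite ler_wpM2l ?expR_ge0// mulrC ler_wpM2l// ltW.
have pt := E p wp ps px pw; have qt := E q wq qs qx qw.
have pt0 : 0 < p t by apply: lt_le_trans pt; rewrite mulr_gt0 ?expR_gt0.
have qt0 := glued_gt0 glued pt0.
exists t; split => //; apply/andP; split.
  rewrite /info lerN2 ler_ln ?posrE//.
  by rewrite -[t](cat_take_drop (size s)) ts weight_catl.
move: qt; rewrite -ler_ln ?posrE ?mulr_gt0 ?expR_gt0//.
by rewrite lnM ?posrE ?expR_gt0// expRK /info; lra.
Qed.

(** The words are extended to the common length [N] at a cost of at most [E].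
    The extended word and the length of the original word determine the
    latter, so that at most [N + 1] words have the same extension. *)
Lemma mass_pad al l1 l2 a b N (E : R) : (0 < l1)%N -> (l2 <= N)%N ->
  (forall l, (l1 <= l <= l2)%N -> (e l + c * (N - l).+1)%:R <= E) ->
  mass al l1 l2 a b <= N.+1%:R * expR ((1 + `|al|) * E) * mass al N N a (b + E).
Proof.
move=> l0 lN HE; rewrite !massE; set r1 := seq.filter _ _; set r2 := seq.filter _ _.
set phi := fun s => expR (al * info s) * p s.
have phi0 s : 0 <= phi s by rewrite mulr_ge0 ?expR_ge0.
have r1P s : s \in r1 -> [/\ (0 < size s)%N, (l1 <= size s <= l2)%N, 0 < p s &
    a <= info s <= b].
  rewrite mem_filter mem_words_in => /andP[/andP[? ?] /andP[? ?]]; split => //.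
    exact: leq_trans l0 _.
  exact/andP.
have padP s : {t | s \in r1 -> [/\ size t = N, take (size s) t = s, 0 < p t,
    info s <= info t <= info s + E & expR (- E) * p s <= p t]}.
  apply: cid; have [/r1P[s0 sl ps _]|_] := boolP (s \in r1); last by exists [::].
  have sN : (size s <= N)%N by case/andP: sl => _ /leq_trans; apply.
  have [t [t1 t2 t3 /andP[t4 t5] t6]] := pad_word s0 sN ps.
  exists t => _; split => //.
    by rewrite t4 (le_trans t5)// lerD2l HE.
  apply: le_trans t6; rewrite ler_wpM2r// ler_expR lerN2; exact: HE.
pose h s := (sval (padP s), size s).
rewrite -mulrA mulr_sumr.
apply: (@ler_sum_fibers _ _ _ _ _ _ h phi
  (fun s => expR ((1 + `|al|) * E) * phi s)).
- exact/filter_uniq/words_in_uniq.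
- exact/filter_uniq/words_in_uniq.
- move=> s t sr tr [hst st].
  have [_ <- _ _ _] := svalP (padP s) sr; have [_ <- _ _ _] := svalP (padP t) tr.
  by rewrite hst st.
- by move=> s; rewrite mulr_ge0// expR_ge0.
move=> s sr; have [t1 t2 t3 /andP[t4 t5] t6] := svalP (padP s) sr.
have [_ /andP[sl1 sl2] ps /andP[sa sb]] := r1P _ sr.
have E0 : 0 <= E by apply: le_trans (HE l1 _); rewrite // leqnn (leq_trans sl1).
rewrite /h /= ltnS (leq_trans sl2)//; split => //.
  rewrite mem_filter words_inn mem_words t1 eqxx t3 andbT/=.
  by rewrite (le_trans sa)//= (le_trans t5)// lerD2r.
rewrite /phi; set t := sval _ in t1 t2 t3 t4 t5 t6 *.
apply: (@le_trans _ _ (expR (al * info s) * (expR E * p t))).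
  by rewrite ler_wpM2l ?expR_ge0// -ler_pdivrMl ?expR_gt0// -expRN.
rewrite !mulrA -!expRD ler_wpM2r// ler_expR.
suff : al * info s <= al * info t + `|al| * E by lra.
rewrite -lerBlDl -mulrBr (le_trans (ler_norm _))// normrM ler_wpM2l//.
by rewrite ler_norml; apply/andP; split; lra.
Qed.

End mass.

(** * Exponential growth of masses *)

(** Cousin's lemma: a property of intervals that is inherited by subintervals and
    by unions of adjacent intervals, and holds locally, holds globally. *)
Lemma interval_induction {R : realType} (H : R -> R -> Prop) (a b : R) :
  a <= b ->
  (forall u v u' v', u <= u' -> v' <= v -> H u v -> H u' v') ->
  (forall u v w, u <= v -> v <= w -> H u v -> H v w -> H u w) ->
  (forall x, a <= x <= b -> exists2 d, 0 < d & H (x - d) (x + d)) ->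
  H a b.
Proof.
move=> ab sub glue loc.
pose S := [set t | a <= t <= b /\ H a t].
have Sa : S a.
  split; first by rewrite lexx.
  have [d d0 Hd] := loc a ltac:(by rewrite lexx).
  by apply: sub Hd; rewrite ?gerBl ?lerDl ltW.
have Ssup : has_sup S.
  by split; [exists a|exists b => t [/andP[]]].
set s := sup S.
have as_ : a <= s by apply: (ub_le_sup Ssup.2 Sa).
have sb : s <= b by apply: ge_sup => [|t [/andP[]]//]; exists a.
have [d d0 Hd] := loc s ltac:(by rewrite as_).
have [t [/andP[at_ tb] Hat] st] := sup_adherent d0 Ssup.
have ts : t <= s by apply: (ub_le_sup Ssup.2); split => //; rewrite at_.
have Hm m : s <= m -> m <= s + d -> H a m.
  move=> sm md; apply: (glue _ t) => //; first exact: le_trans ts sm.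
  by apply: sub Hd => //; rewrite ltW.
have [bd|db] := leP b (s + d); first exact: Hm.
have Sd : S (s + d).
  split; last by apply: Hm => //; rewrite lerDl ltW.
  by rewrite (ltW db) andbT (le_trans as_)// lerDl ltW.
have := ub_le_sup Ssup.2 Sd; rewrite -/s gerDl leNgt d0//.
Qed.

Section growth.
Context {R : realType} {A : finType} {c : nat} {e : nat -> nat}.
Context {p q : seq A -> R} (glued : glued_words c e p q).
Implicit Types (s t u v w : seq A) (al a b x y r : R).
Local Notation mass := (@mass R A p q).

(** The error of one block: gluing costs [e n], padding [c * e n] and the
    rest covers factors such as [N + 1] and the rounding of [N / (n + e n)]. *)
Definition slack n := (c.+1 * e n + 5)%N.

Lemma slack_near (eps : R) : 0 < eps ->
  \forall n \near \oo, (slack n)%:R <= eps * n%:R.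
Proof.
apply: sublinear_near; have := sublinearD
  (sublinearZ c.+1 (glued_sublinear glued)) (sublinear_cst 5).
by apply: sublinear_le => n; rewrite -natrM -natrD.
Qed.

Lemma le_slack n : (e n <= slack n)%N.
Proof. by rewrite /slack mulSn -addnA leq_addr. Qed.

Lemma natS_le_expR (eps : R) : 0 < eps ->
  \forall n \near \oo, n.+1%:R <= expR (eps * n%:R).
Proof.
move=> e0; near=> n.
have n0 : 0 <= eps * n%:R by rewrite mulr_ge0// ltW.
apply: le_trans (expR_ge1Dxn 1 n0); rewrite -natr1 addrC lerD2l exprMn expr2 [n%:R ^+ _]expr2.
rewrite mulrA ler_pdivlMr// mulrC ler_wpM2r//.
rewrite -ler_pdivrMl ?mulr_gt0//; near: n; exact: nbhs_infty_ger.
Unshelve. all: by end_near. Qed.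

Lemma divn_near n (y : R) : (0 < n)%N -> \forall N \near \oo,
  y <= (N %/ n)%:R :> R.
Proof.
move=> n0; pose M := (Num.truncn y).+1.
near=> N.
have yM : y <= M%:R by apply/ltW; rewrite /M truncnS_gt.
apply: (le_trans yM); rewrite ler_nat leq_divRL//.
near: N; exact: nbhs_infty_ge.
Unshelve. all: end_near. Qed.

(** Cutting [N] into [k] blocks of length [n] with their connecting words, and
    padding: the number of blocks grows linearly with [N], so that everything
    that is subexponential in [N] is absorbed by the slack of one block. *)
Lemma mass_pow al n a b : (0 < n)%N -> \forall N \near \oo,
  let k := (N %/ (n + e n))%N in
  mass al n n a b ^+ k <= expR ((2 + `|al|) * (k%:R * (slack n).-1%:R)) *
    mass al N N (k%:R * (a - (slack n).-1%:R)) (k%:R * (b + (slack n).-1%:R)).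
Proof.
move=> n0; set m := (n + e n)%N; have m0 : (0 < m)%N by rewrite ltn_addr.
have mr0 : 0 < m%:R :> R by rewrite ltr0n.
have [B HB] := glued_sublinear glued (eps := (2 * m%:R)^-1)
  ltac:(by rewrite invr_gt0 mulr_gt0).
near=> N => /=.
have kB : B <= (N %/ m)%:R by near: N; exact: divn_near.
have kc : (c * m.+1)%:R <= (N %/ m)%:R :> R by near: N; exact: divn_near.
have k4 : (4 * m)%:R <= (N %/ m)%:R :> R by near: N; exact: divn_near.
have k1 : 1 <= (N %/ m)%:R :> R by near: N; exact: divn_near.
set k := (N %/ m)%N in kB kc k4 k1 *.
have k0 : (0 < k)%N by rewrite -(ler_nat R).
have kN : (k * m <= N)%N by rewrite /k leq_divM.
have Nk : (N < k.+1 * m)%N by rewrite /k ltn_ceil.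
have al0 : 0 <= `|al| by [].
apply: (le_trans (mass_iter glued al a b n0 k0)).
have kn0 : (0 < k * n)%N by rewrite muln_gt0 k0.
have HE l : (k * n <= l <= k * m)%N ->
    (e l + c * (N - l).+1)%:R <= k%:R * (c * e n + 3)%:R :> R.
  move=> /andP[l1 l2].
  have : (e l)%:R <= k%:R * 2 :> R.
    apply: (le_trans (HB l)).
    have : (2 * m%:R)^-1 * l%:R <= k%:R :> R.
      rewrite ler_pdivrMl ?mulr_gt0// mulrAC -mulrA -natrM.
      by rewrite (le_trans (_ : _ <= (k * m)%:R)) ?ler_nat// ler_peMl ?ler1n.
    by lra.
  have : (c * (N - l).+1)%:R <= k%:R * (c * e n)%:R + k%:R :> R.
    apply: (@le_trans _ _ (k * (c * e n) + c * m.+1)%:R); last first.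
      by rewrite natrD natrM lerD2l.
    rewrite ler_nat mulnCA -mulnDr leq_mul2l orbC; apply/orP; left.
    by move: Nk l1; rewrite /m mulSn mulnDr; clear; lia.
  by rewrite natrD mulrDr [(c * e n + 3)%:R]natrD; lra.
rewrite (le_trans (ler_wpM2l (expR_ge0 _)
  (mass_pad glued al _ _ kn0 kN HE)))//.
have NE : N.+1%:R <= expR k%:R :> R.
  have := expR_ge1Dxn 1 (ler0n R k); apply: le_trans.
  apply: (@le_trans _ _ (k.+1 * m)%:R); first by rewrite ler_nat.
  rewrite natrM -natr1 mulrDl mul1r.
  rewrite (_ : 2`!%:R = 2)// expr2.
  have mk : m%:R <= k%:R * m%:R :> R by rewrite ler_peMl.
  have : k%:R * (4 * m)%:R <= k%:R * k%:R :> R by rewrite ler_wpM2l.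
  by rewrite natrM; nra.
rewrite [leLHS]mulrA [X in X * _ <= _]mulrA; apply: ler_pM.
- by rewrite !mulr_ge0 ?expR_ge0.
- exact: (mass_ge0 glued).
- rewrite mulrAC (le_trans (ler_wpM2l _ NE))// ?mulr_ge0 ?expR_ge0// -!expRD.
  rewrite ler_expR.
  rewrite (_ : (slack n).-1 = (c * e n + e n + 4)%N); last first.
    by rewrite /slack mulSn addnS /= [(e n + _)%N]addnC.
  rewrite !natrD.
  set x := (c * e n)%:R; set y := (e n)%:R; set K := k%:R.
  have x0 : 0 <= x by [].
  have y0 : 0 <= y by [].
  have Kx : 0 <= K * x by rewrite mulr_ge0.
  have aKx : 0 <= `|al| * K by rewrite mulr_ge0.
  by nra.
- apply: (le_mass glued) => //; rewrite -?mulrDr ler_wpM2l//.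
    rewrite lerD2l lerN2 ler_nat; move: (le_slack n); rewrite /slack; clear; lia.
  rewrite -addrA lerD2l -natrD ler_nat /slack mulSn; clear; lia.
Unshelve. all: by end_near. Qed.

End growth.

Section block_growth.
Context {R : realType} {A : finType} {c : nat} {e : nat -> nat}.
Context {p q : seq A -> R} (glued : glued_words c e p q).
Implicit Types (s t u v w : seq A) (al a b x y r : R).
Local Notation mass := (@mass R A p q).
Local Notation slack := (@slack c e).

(** The number of blocks is replaced by the real number [N / (n + e n)]; the
    unit in which [slack n] and [(slack n).-1] differ pays for the rounding. *)
Lemma mass_blocks al n a b L : (0 < n)%N -> expR L <= mass al n n a b ->
  \forall N \near \oo,
  let k : R := N%:R / (n + e n)%:R in
  expR (k * (L - (2 + `|al|) * (slack n)%:R)) <=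
    mass al N N (k * (a - (slack n)%:R)) (k * (b + (slack n)%:R)).
Proof.
move=> n0 Lm; set m := (n + e n)%N; have m0 : (0 < m)%N by rewrite ltn_addr.
have mr0 : 0 < m%:R :> R by rewrite ltr0n.
pose d := (slack n).-1; have dE : (slack n)%:R = d%:R + 1 :> R.
  by rewrite natr1 prednK// /slack addnS.
have large y : \forall N \near \oo, `|y| <= N%:R / m%:R :> R.
  near=> N; rewrite ler_pdivlMr//.
  by near: N; exact: nbhs_infty_ger.
have [N0 _ Hpow] := mass_pow glued al a b n0.
near=> N => /=.
have H1 : `|L - (2 + `|al|) * d%:R| <= N%:R / m%:R by near: N; exact: large.
have H2 : `|a - d%:R| <= N%:R / m%:R by near: N; exact: large.
have H3 : `|b + d%:R| <= N%:R / m%:R by near: N; exact: large.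
have N0N : (N0 <= N)%N by near: N; exact: nbhs_infty_ge.
have /= := Hpow N N0N.
set k := (N %/ m)%N; set K := N%:R / m%:R in H1 H2 H3 *.
have kK : k%:R <= K by rewrite ler_pdivlMr// -natrM ler_nat leq_divM.
have Kk : K <= k%:R + 1.
  by rewrite natr1 ler_pdivrMr// -natrM ler_nat ltnW// ltn_ceil.
have approx y : `|y| <= K -> K * (y - 1) <= k%:R * y <= K * (y + 1).
  move=> yK; have : `|K * y - k%:R * y| <= K.
    rewrite -mulrBl normrM (le_trans _ yK)// ler_piMl// ger0_norm; lra.
  by rewrite ler_norml => /andP[? ?]; apply/andP; split; lra.
rewrite -/d => Hm.
have al0 : 0 <= `|al| by [].
have /andP[K1 _] := approx _ H1.
have /andP[K2 _] := approx _ H2.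
have /andP[_ K3] := approx _ H3.
have K0 : 0 <= K by apply: le_trans H1.
apply: (@le_trans _ _ (mass al N N (k%:R * (a - d%:R)) (k%:R * (b + d%:R)))).
  rewrite -(ler_pM2l (expR_gt0 ((2 + `|al|) * (k%:R * d%:R)))).
  apply: le_trans Hm; rewrite -expRD.
  apply: (@le_trans _ _ (expR L ^+ k)); last first.
    by rewrite lerXn2r ?nnegrE ?expR_ge0// (mass_ge0 glued).
  rewrite -expRM_natl ler_expR dE.
  have : 0 <= K * `|al| by rewrite mulr_ge0.
  by move: K1 K0; clear; lra.
apply: (le_mass glued) => //.
  by rewrite dE opprD addrA.
by rewrite dE addrA.
Unshelve. all: by end_near. Qed.

End block_growth.

(** * Sublevel sets of the rate function *)

Section rate_levels.
Context {R : realType} {A : finType} {c : nat} {e : nat -> nat}.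
Context {p q : seq A -> R} (glued : glued_words c e p q).
Implicit Types (s t u v w : seq A) (al a b x y r : R).
Let wp := glued_weightl glued.
Local Notation mass := (@mass R A p q).
Local Notation info := (@info R A q).
Local Notation slack := (@slack c e).

(** The rate function is defined below by these sublevel sets. The estimate
    is required along all large lengths, hence is a statement on a limit
    inferior; by [rate_le_frequent] infinitely many lengths would do, and it
    is this equality of two growth rates that yields a large deviation
    principle. *)
Definition rate_le x r := forall eps : R, 0 < eps -> \forall N \near \oo,
  expR (- (N%:R * (r + eps))) <= mass 0 N N (N%:R * (x - eps)) (N%:R * (x + eps)).

Lemma rate_le_closed x r :
  (forall eps : R, 0 < eps -> exists y r',
     [/\ `|y - x| <= eps, r' <= r + eps & rate_le y r']) -> rate_le x r.
Proof.
move=> H eps e0; have e20 : 0 < eps / 2 by rewrite divr_gt0.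
have [y [r' [yx sr Hy]]] := H _ e20.
have [N0 _ HN] := Hy _ e20; exists N0 => // N /HN /= {}HN.
apply: le_trans (le_trans _ HN) _.
  by rewrite ler_expR lerN2 ler_wpM2l//; lra.
move: yx; rewrite ler_norml => /andP[yx1 yx2].
by apply: (le_mass glued) => //; rewrite ler_wpM2l//; lra.
Qed.

Lemma rate_le_mono x r r' : r <= r' -> rate_le x r -> rate_le x r'.
Proof.
move=> rs Hr; apply: rate_le_closed => eps e0; exists x, r.
by rewrite subrr normr0; split => //; lra.
Qed.

Lemma mass0_le1 N a b : mass 0 N N a b <= 1.
Proof.
rewrite -(weight_words N wp) /mass words_inn -big_filter.
under eq_bigr do rewrite mul0r expR0 mul1r.
apply: ler_sum_sub.
- exact/filter_uniq/words_uniq.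
- by move=> s; rewrite mem_filter => /andP[].
- exact: words_uniq.
- by move=> s; case: wp.
Qed.

Lemma rate_le_ge0 x r : rate_le x r -> 0 <= x /\ 0 <= r.
Proof.
move=> H; split.
  rewrite leNgt; apply/negP => x0.
  have [N0 _ HN] := H (- x / 2) ltac:(by lra).
  have /= := HN N0.+1 (leqnSn _).
  rewrite leNgt => /negP; apply.
  rewrite (_ : mass _ _ _ _ _ = 0) ?expR_gt0// /mass big1_seq// => s.
  move=> /andP[/andP[_ /andP[_ sx]] _]; exfalso.
  have := info_ge0 glued s; rewrite leNgt => /negP; apply.
  apply: (le_lt_trans sx); rewrite pmulr_rlt0//; lra.
rewrite leNgt; apply/negP => r0.
have [N0 _ HN] := H (- r / 2) ltac:(by lra).
have /= := HN N0.+1 (leqnSn _).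
rewrite leNgt => /negP; apply; apply: (le_lt_trans (mass0_le1 _ _ _)).
by rewrite -[ltLHS]expR0 ltr_expR oppr_gt0 pmulr_rlt0//; lra.
Qed.

(** Masses along infinitely many lengths suffice: [mass_blocks] transports them
    to all large lengths. *)
Lemma rate_le_frequent x r :
  (forall eps : R, 0 < eps -> forall n0, exists2 n, (n0 <= n)%N &
    expR (- (n%:R * (r + eps))) <= mass 0 n n (n%:R * (x - eps)) (n%:R * (x + eps))) ->
  rate_le x r.
Proof.
move=> H eps e0.
pose d := eps / (3 + `|x| + `|r|).
have den0 : 0 < 3 + `|x| + `|r| by rewrite -addrA ltr_wpDr// addr_ge0.
have d0 : 0 < d by rewrite divr_gt0.
have dE : d * 3 + d * `|x| + d * `|r| = eps.
  by rewrite -!mulrDr /d divfK// gt_eqF.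
have [n0 _ Hn0] := slack_near glued d0.
have [n nn0 Hn] := H d d0 n0.+1.
have n_gt0 : (0 < n)%N by exact: leq_ltn_trans nn0.
have /= sn := Hn0 n (ltnW nn0).
have en : (e n)%:R <= d * n%:R by apply: le_trans sn; rewrite ler_nat le_slack.
have [N0 _ HN] := mass_blocks glued n_gt0 Hn.
exists N0 => // N /HN /=.
rewrite normr0 addr0 -/(slack n); set m := (n + e n)%N.
have m0 : 0 < m%:R :> R by rewrite ltr0n /m ltn_addr.
have mE : m%:R = n%:R + (e n)%:R :> R by rewrite natrD.
have n0r : 0 < n%:R :> R by rewrite ltr0n.
have e0r : 0 <= (e n)%:R :> R by [].
have key (y z : R) : y <= m%:R * z -> N%:R / m%:R * y <= N%:R * z.
  move=> yz; rewrite mulrAC -mulrA ler_wpM2l// ler_pdivrMr//.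
  by rewrite mulrC.
have absM (y : R) : - (d * n%:R * `|y|) <= (e n)%:R * y /\
    (e n)%:R * y <= d * n%:R * `|y|.
  have : `|(e n)%:R * y| <= d * n%:R * `|y| by rewrite normrM ger0_norm// ler_wpM2r.
  by rewrite ler_norml => /andP[].
have [x1 x2] := absM x; have [r1 r2] := absM r.
have epsn : n%:R * eps = d * n%:R * 3 + d * n%:R * `|x| + d * n%:R * `|r|.
  by rewrite -dE; ring.
have xd : 0 <= d * n%:R * `|x| by rewrite !mulr_ge0// ltW.
have rd : 0 <= d * n%:R * `|r| by rewrite !mulr_ge0// ltW.
have ee : 0 <= (e n)%:R * eps by rewrite mulr_ge0// ltW.
have dn : 0 <= d * n%:R by rewrite mulr_ge0// ltW.
move=> HH; apply: le_trans (le_trans _ HH) _.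
  rewrite ler_expR -[leRHS]opprK lerN2 -mulrN.
  by apply: key; rewrite mE; lra.
apply: (le_mass glued) => //.
  rewrite -lerN2 -[leLHS]mulrN -[leRHS]mulrN; apply: key.
  by rewrite mE; lra.
by apply: key; rewrite mE; lra.
Qed.

Lemma mass_split al N a b b' :
  mass al N N a b' <= mass al N N a b + mass al N N b b'.
Proof.
rewrite /mass [leLHS]big_mkcond [X in _ <= X + _]big_mkcond.
rewrite [X in _ <= _ + X]big_mkcond -big_split /=; apply: ler_sum => s _.
have f0 : 0 <= expR (al * info s) * p s by rewrite mulr_ge0 ?expR_ge0//; case: wp.
case: ifP => [/andP[-> /andP[-> ->]]|_] /=; last first.
  by rewrite addr_ge0//; case: ifP.
rewrite andbT; case: (leP (info s) b) => [_|/ltW ->]; last by rewrite add0r.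
by rewrite lerDl; case: ifP.
Qed.

Lemma mass_tilt al N x d : 0 <= d ->
  mass al N N (N%:R * (x - d)) (N%:R * (x + d)) <=
  expR (N%:R * (al * x + `|al| * d)) * mass 0 N N (N%:R * (x - d)) (N%:R * (x + d)).
Proof.
move=> d0; rewrite /mass mulr_sumr; apply: ler_sum => s.
move=> /andP[ps /andP[s1 s2]].
rewrite mul0r expR0 mul1r ler_wpM2r// ?(ltW ps)// ler_expR.
suff : al * (info s - N%:R * x) <= `|al| * (N%:R * d) by lra.
rewrite (le_trans (ler_norm _))// normrM ler_wpM2l//.
by rewrite ler_norml; apply/andP; split; lra.
Qed.

(** Some point carries the exponential growth rate of a compact window: otherwise
    every point has a neighbourhood of smaller growth, and finitely many of them
    cover the window. *)
Lemma rate_le_window al a b L : a <= b ->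
  (forall eps : R, 0 < eps -> forall n0, exists2 N, (n0 <= N)%N &
     expR (N%:R * (L - eps)) <= mass al N N (N%:R * a) (N%:R * b)) ->
  exists2 x, a <= x <= b & rate_le x (al * x - L).
Proof.
move=> ab freq; apply: contrapT => nex.
pose H (u v : R) := exists2 eps : R, 0 < eps & \forall N \near \oo,
  mass al N N (N%:R * u) (N%:R * v) <= expR (N%:R * (L - eps)).
suff [eps e0 [n0 _ Hn0]] : H a b.
  have [N n0N] := freq (eps / 2) ltac:(by lra) (maxn n0 1).
  rewrite geq_max in n0N; case/andP: n0N => n0N N0.
  move=> /le_trans/(_ (Hn0 N n0N)); rewrite ler_expR ler_pM2l ?ltr0n//; lra.
apply: interval_induction => //.
- move=> u v u' v' uu vv [eps e0 [n0 _ Hn]]; exists eps => //.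
  exists n0 => // N /Hn /=; apply: le_trans.
  by apply: (le_mass glued) => //; rewrite ler_wpM2l.
- move=> u v w _ _ [e1 e10 H1] [e2 e20 H2].
  exists (Num.min e1 e2 / 2); first by rewrite divr_gt0// lt_min e10.
  near=> N.
  have m0 : 0 < Num.min e1 e2 by rewrite lt_min e10.
  set m := Num.min e1 e2 in m0 *.
  have N2 : 2 <= expR (N%:R * (m / 2)).
    have := expR_ge1Dx (N%:R * (m / 2)); apply: le_trans.
    suff : 1 <= N%:R * (m / 2) by lra.
    by rewrite -ler_pdivrMr ?divr_gt0//; near: N; exact: nbhs_infty_ger.
  rewrite (_ : N%:R * (L - m / 2) = N%:R * (m / 2) + N%:R * (L - m)); last by lra.
  rewrite expRD; apply: le_trans (mass_split _ _ _ (N%:R * v) _) _.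
  apply: (@le_trans _ _ (2 * expR (N%:R * (L - m)))).
    rewrite [leRHS]mulr_natl mulr2n; apply: lerD.
      apply: (@le_trans _ _ (expR (N%:R * (L - e1)))); first by near: N.
      by rewrite ler_expR ler_wpM2l// lerD2l lerN2 ge_min lexx.
    apply: (@le_trans _ _ (expR (N%:R * (L - e2)))); first by near: N.
    by rewrite ler_expR ler_wpM2l// lerD2l lerN2 ge_min lexx orbT.
  by rewrite ler_wpM2r// expR_ge0.
move=> x xab.
have nx : ~ rate_le x (al * x - L) by move=> Hx; apply: nex; exists x.
have [eps e0 [n0 Hn0]] : exists2 eps : R, 0 < eps & exists n0, forall n, (n0 <= n)%N ->
    mass 0 n n (n%:R * (x - eps)) (n%:R * (x + eps)) <
    expR (- (n%:R * (al * x - L + eps))).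
  apply: contrapT => nH; apply: nx; apply: rate_le_frequent => eps e0 n0.
  apply: contrapT => nn; apply: nH; exists eps => //; exists n0 => n nn0.
  by rewrite ltNge; apply/negP => h; apply: nn; exists n.
pose d := Num.min eps (eps / (2 * (1 + `|al|))).
have den0 : 0 < 1 + `|al| by rewrite ltr_wpDr.
have d0 : 0 < d by rewrite lt_min e0 divr_gt0// mulr_gt0.
have ad : `|al| * d <= eps / 2.
  apply: (@le_trans _ _ ((1 + `|al|) * (eps / (2 * (1 + `|al|))))).
    by apply: ler_pM; rewrite ?(ltW d0)// ?lerDr// ge_min lexx orbT.
  rewrite [leLHS](_ : _ = eps / 2)//; field.
  by rewrite gt_eqF.
have de : d <= eps by rewrite ge_min lexx.
exists d => //; exists (eps / 2); first by rewrite divr_gt0.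
exists n0 => // N /Hn0 HN /=.
apply: le_trans (mass_tilt _ _ _ (ltW d0)) _.
apply: (@le_trans _ _ (expR (N%:R * (al * x + `|al| * d)) *
    expR (- (N%:R * (al * x - L + eps))))).
  rewrite ler_wpM2l ?expR_ge0// (le_trans _ (ltW HN))//.
  by apply: (le_mass glued) => //; rewrite ler_wpM2l//; lra.
rewrite -expRD ler_expR.
rewrite -mulrN -mulrDr ler_wpM2l//; lra.
Unshelve. all: by end_near. Qed.

(** For a fixed [n] the window is compact although [info / n] may be
    unbounded as [n] grows. This is why the upper bounds on closed sets and
    on the pressure need no tightness: mass far away at one length produces a
    point [x] of small rate far away. *)
Lemma rate_le_mass al n a b L : (0 < n)%N -> a <= b ->
  expR L <= mass al n n a b ->
  exists x, [/\ a - (slack n)%:R <= x * (n + e n)%:R <= b + (slack n)%:R &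
    rate_le x (al * x - (L - (2 + `|al|) * (slack n)%:R) / (n + e n)%:R)].
Proof.
move=> n0 ab Hm; have [N0 _ HN] := mass_blocks glued n0 Hm.
set m := (n + e n)%N in HN *.
have m0 : 0 < m%:R :> R by rewrite ltr0n /m ltn_addr.
have [||x /andP[x1 x2] Hx] := @rate_le_window al ((a - (slack n)%:R) / m%:R)
   ((b + (slack n)%:R) / m%:R) ((L - (2 + `|al|) * (slack n)%:R) / m%:R).
- rewrite ler_pM2r ?invr_gt0// -[leRHS]addr0 -lerBlDr; have := ler0n R (slack n); lra.
- move=> eps e0 n1; exists (maxn n1 N0); rewrite ?leq_maxl//.
  have /= := HN (maxn n1 N0) (leq_maxr _ _); set N := maxn _ _.
  rewrite -!mulrA ![m%:R^-1 * _]mulrC; apply: le_trans.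
  by rewrite ler_expR ler_wpM2l// gerBl ltW.
- by exists x; split => //; rewrite -ler_pdivrMr// x1 -ler_pdivlMr.
Qed.

End rate_levels.

Section convexity.
Context {R : realType} {A : finType} {c : nat} {e : nat -> nat}.
Context {p q : seq A -> R} (glued : glued_words c e p q).
Implicit Types (s : seq A) (al a b x y r : R).
Local Notation mass := (@mass R A p q).
Local Notation slack := (@slack c e).
Local Notation rate_le := (@rate_le R A p q).

(** A word of length about [t * N] with [info] per letter near [x] is glued
    to one of length about [(1 - t) * N] with [info] per letter near [y], and
    the result is padded to length [N]. *)
Lemma rate_le_convex x y r r' t : 0 < t < 1 -> rate_le x r -> rate_le y r' ->
  rate_le (t * x + (1 - t) * y) (t * r + (1 - t) * r').
Proof.
move=> /andP[t0 t1] Hx Hy eps e0.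
have [x0 r0] := rate_le_ge0 glued Hx; have [y0 r'0] := rate_le_ge0 glued Hy.
(* [D] bounds the sum of the coefficients of the errors of order [d * N]: those
   of the two estimates, of gluing, of padding and of rounding the lengths *)
pose D : R := 8 + 2 * c%:R + x + y.
have D0 : 8 <= D by rewrite /D; have := ler0n R c; lra.
pose d := Num.min (eps / D) 2^-1.
have d0 : 0 < d by rewrite lt_min divr_gt0//; lra.
have d1 : d <= 2^-1 by rewrite ge_min lexx orbT.
have dD : d * D <= eps.
  by rewrite -ler_pdivlMr; [rewrite ge_min lexx|lra].
(* about [d * N] letters are left for the connecting word and the padding *)
pose n1 N := Num.truncn (t * (1 - d) * N%:R).
pose n2 N := Num.truncn ((1 - t) * (1 - d) * N%:R).
have t'0 : 0 < 1 - t by rewrite subr_gt0.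
have t'1 : 1 - t <= 1 by rewrite gerBl ltW.
have d'0 : 0 < 1 - d by move: d1; clear -glued; lra.
have d20 : 0 < d / 2 by rewrite divr_gt0.
have td0 : 0 < t * (1 - d) by rewrite mulr_gt0.
have td'0 : 0 < (1 - t) * (1 - d) by rewrite mulr_gt0.
have truncP (z : R) N : 0 < z -> (Num.truncn (z * N%:R))%:R <= z * N%:R /\
    z * N%:R <= (Num.truncn (z * N%:R))%:R + 1.
  move=> z0; have /truncn_itv/andP[h1 h2] : 0 <= z * N%:R by rewrite mulr_ge0// ltW.
  by split=> //; rewrite natr1 ltW.
have n1P N := truncP _ N td0; have n2P N := truncP _ N td'0.
have trunc_near (z : R) m : 0 < z -> \forall N \near \oo,
    (m <= Num.truncn (z * N%:R))%N.
  move=> z0; near=> N.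
  rewrite truncn_ge_nat; last by rewrite mulr_ge0// ltW.
  rewrite -ler_pdivrMl//.
  by near: N; exact: nbhs_infty_ger.
have [N1 _ HN1] := Hx _ d0; have [N2 _ HN2] := Hy _ d0.
have [B HB] := glued_sublinear glued d20.
have [N3 _ HN3] := sublinear_near (glued_sublinear glued) d0.
near=> N.
have h1 : (maxn N1 (maxn N3 1) <= n1 N)%N by near: N; exact: trunc_near.
have h2 : (maxn N2 1 <= n2 N)%N by near: N; exact: trunc_near.
have NS : N.+1%:R <= expR (d * N%:R) by near: N; exact: natS_le_expR.
have BN : B <= d / 2 * N%:R.
  by rewrite -ler_pdivrMl ?divr_gt0//; near: N; exact: nbhs_infty_ger.
have xN : x <= d * N%:R.
  by rewrite -ler_pdivrMl//; near: N; exact: nbhs_infty_ger.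
have yN : y <= d * N%:R.
  by rewrite -ler_pdivrMl//; near: N; exact: nbhs_infty_ger.
have cN : 3 * c%:R <= d * N%:R.
  by rewrite -ler_pdivrMl//; near: N; exact: nbhs_infty_ger.
move: h1 h2; rewrite !geq_max => /and3P[h1 h3 h4] /andP[h5 h6].
have M1 := HN1 _ h1; have M2 := HN2 _ h5; have e1 := HN3 _ h3.
rewrite /= in M1 M2 e1.
have [u1 u2] := n1P N; have [v1 v2] := n2P N.
rewrite -/(n1 N) in u1 u2; rewrite -/(n2 N) in v1 v2.
move: (n1 N) (n2 N) => k1 k2 in h1 h3 h4 h5 h6 M1 M2 e1 u1 u2 v1 v2.
have Nr0 : 0 <= N%:R :> R by [].
move: NS BN xN yN cN e1 u1 u2 v1 v2; set n := N%:R => NS BN xN yN cN e1 u1 u2 v1 v2.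
have k1r0 : 0 <= k1%:R :> R by []. have k2r0 : 0 <= k2%:R :> R by [].
have k12 : k1%:R + k2%:R <= (1 - d) * n.
  by move: u1 v1; clear -glued; lra.
have k12' : (1 - d) * n - 2 <= k1%:R + k2%:R.
  by move: u2 v2; clear -glued; lra.
have tdn : 0 <= t * (d * n) by rewrite !mulr_ge0// ltW.
have tdn' : 0 <= (1 - t) * (d * n) by rewrite !mulr_ge0// ltW.
have k1tn : k1%:R <= t * n by move: u1 tdn; clear -glued; lra.
have k2tn : k2%:R <= (1 - t) * n by move: v1 tdn'; clear -glued; lra.
have dk1 : d * k1%:R <= d * (t * n) by rewrite ler_wpM2l// ltW.
have dn0 : 0 <= d * n by rewrite mulr_ge0// ltW.
have ekr : (e k1)%:R <= d * n.
  by rewrite (le_trans e1)//; move: dk1 tdn'; clear -glued; lra.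
have kN : (k1 + e k1 + k2 <= N)%N.
  by rewrite -(ler_nat R) !natrD -/n; move: ekr k12; clear -glued; lra.
have k12d : (k1%:R + k2%:R) * d <= n * d.
  by rewrite ler_wpM2r ?(ltW d0)//; move: k12 dn0; clear -glued; lra.
(* the letters that remain to be padded number at most [d * n + 3] *)
set E := d * n + c%:R * (2 * (d * n)) + d * n.
have HE l : (k1 + k2 <= l <= k1 + e k1 + k2)%N -> (e l + c * (N - l).+1)%:R <= E.
  move=> /andP[l1 l2]; have lN : (l <= N)%N by exact: leq_trans kN.
  have : (e l)%:R <= d * n.
    apply: (le_trans (HB l)).
    have : d / 2 * l%:R <= d / 2 * n by rewrite ler_wpM2l ?ler_nat// ltW.
    by move: BN; clear -glued; lra.
  have : (N - l).+1%:R <= d * n + 3.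
    rewrite -natr1 natrB// -/n; have : (k1 + k2)%:R <= l%:R :> R by rewrite ler_nat.
    by rewrite natrD; move: k12'; clear -glued; lra.
  move=> /(ler_wpM2l (ler0n R c)); rewrite -natrM.
  have : 0 <= c%:R * (d * n) by rewrite mulr_ge0.
  by rewrite natrD /E; move: cN; clear -glued; lra.
have H := @mass_glue _ _ _ _ _ _ glued 0 k1 k2 k2 (k1%:R * (x - d))
  (k1%:R * (x + d)) (k2%:R * (y - d)) (k2%:R * (y + d)) h4 h6.
have k12_0 : (0 < k1 + k2)%N by rewrite ltn_addr.
have {}H := le_trans H (ler_wpM2l (expR_ge0 _) (mass_pad glued _ _ _ k12_0 kN HE)).
have {}H := le_trans (ler_pM (expR_ge0 _) (expR_ge0 _) M1 M2) H.
rewrite normr0 !addr0 in H.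
set M := mass _ _ _ _ _ in H.
have M0 : 0 <= M by exact: (mass_ge0 glued).
have cdn : 0 <= c%:R * (d * n) by rewrite mulr_ge0.
have Dn : d * n * D <= n * eps by rewrite mulrAC mulrC ler_wpM2l.
have xdn : 0 <= x * (d * n) by rewrite mulr_ge0.
have ydn : 0 <= y * (d * n) by rewrite mulr_ge0.
apply: (@le_trans _ _ M).
  rewrite -(ler_pM2l (expR_gt0 (2 * (e k1)%:R + d * n + E))).
  apply: (@le_trans _ _ (expR (2 * (e k1)%:R) * (N.+1%:R * expR (1 * E) * M))).
    apply: le_trans H; rewrite -!expRD ler_expR.
    have a1 : k1%:R * r <= t * n * r by rewrite ler_wpM2r.
    have a2 : k2%:R * r' <= (1 - t) * n * r' by rewrite ler_wpM2r.
    by move: a1 a2 k12d Dn ekr dn0 cdn xdn ydn; rewrite /E /D; clear -glued; lra.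
  rewrite mul1r !expRD mulrA mulrA ler_wpM2r// -!mulrA ler_wpM2l ?expR_ge0//.
  by rewrite ler_wpM2r ?expR_ge0.
apply: (le_mass glued) => //.
  have a1 : (t * (1 - d) * n - 1) * x <= k1%:R * x by rewrite ler_wpM2r// lerBlDr.
  have a2 : ((1 - t) * (1 - d) * n - 1) * y <= k2%:R * y by rewrite ler_wpM2r// lerBlDr.
  have a4 : t * (x * (d * n)) <= x * (d * n) by rewrite ler_piMl// ltW.
  have a5 : (1 - t) * (y * (d * n)) <= y * (d * n) by rewrite ler_piMl.
  by move: a1 a2 k12d a4 a5 Dn ekr dn0 cdn xdn ydn xN yN; rewrite /E /D; clear -glued; lra.
have a1 : k1%:R * x <= t * n * x by rewrite ler_wpM2r.
have a2 : k2%:R * y <= (1 - t) * n * y by rewrite ler_wpM2r.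
by move: a1 a2 k12d Dn ekr dn0 cdn xdn ydn; rewrite /E /D; clear -glued; lra.
Unshelve. all: by end_near. Qed.

End convexity.

Section tails_and_sums.
Context {R : realType} {A : finType} {c : nat} {e : nat -> nat}.
Context {p q : seq A -> R} (glued : glued_words c e p q).
Implicit Types (s w : seq A) (al a b x y z r : R).
Let wp := glued_weightl glued.
Local Notation mass := (@mass R A p q).
Local Notation info := (@info R A q).
Local Notation slack := (@slack c e).
Local Notation rate_le := (@rate_le R A p q).

(** Convexity between two points at which the rate is bounded by the same
    affine function. The cases of interest are the slopes 0 (level sets) and
    1 (the bound by the identity for self-information). *)
Lemma rate_le_between x y z r t : x <= z <= y -> rate_le x (x * t + r) ->
  rate_le y (y * t + r) -> rate_le z (z * t + r).
Proof.
move=> /andP[]; rewrite le_eqVlt => /predU1P[-> //|xz].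
rewrite le_eqVlt => /predU1P[-> //|zy] Hx Hy.
have yx : 0 < y - x by lra.
pose u := (y - z) / (y - x).
have u0 : 0 < u by rewrite divr_gt0//; lra.
have u1 : u < 1 by rewrite ltr_pdivrMr// mul1r; lra.
have uE : u * (y - x) = y - z by rewrite /u divfK// gt_eqF.
have := rate_le_convex glued (t := u) ltac:(by rewrite u0) Hx Hy.
have -> : u * x + (1 - u) * y = z by lra.
rewrite (_ : u * (x * t + r) + _ = z * t + r)//.
by rewrite -[z](_ : u * x + (1 - u) * y = z); lra.
Qed.

Lemma mass_gt0_le N al a b : 0 < mass al N N a b ->
  a <= b /\ 0 <= b.
Proof.
move=> m0; have [s /andP[_ /andP[sa sb]]] : exists s, (0 < p s) && (a <= info s <= b).
  apply: contrapT => ns; move: m0; rewrite /mass big_pred0 ?ltxx// => s.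
  by apply/negP => h; apply: ns; exists s.
by split; [exact: le_trans sb|apply: le_trans sb; exact: info_ge0 glued s].
Qed.

(** A larger tail would, by [rate_le_mass], produce a point of the sublevel
    set of [K] beyond [x] or arbitrarily close to [x]. As the sublevel set is
    closed and convex, it would contain [x]. *)
Lemma rate_le_left x y K eps : rate_le y K -> x <= y -> ~ rate_le x K -> 0 < eps ->
  \forall N \near \oo, mass 0 N N 0 (N%:R * x) <= expR (- (N%:R * (K - eps))).
Proof.
move=> Hy xy nx eps0; apply: contrapT => nlim; apply: nx.
have K0 := (rate_le_ge0 glued Hy).2.
apply: (rate_le_closed glued) => d d0.
have [N1 _ HN1] := slack_near glued (eps := eps / 2) ltac:(lra).
have [N2 _ HN2] := slack_near glued d0.
have [N NN Hm] : exists2 N, (maxn 1 (maxn N1 N2) <= N)%N &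
    expR (- (N%:R * (K - eps))) < mass 0 N N 0 (N%:R * x).
  apply: contrapT => nN; apply: nlim; exists (maxn 1 (maxn N1 N2)) => // N NN /=.
  by rewrite leNgt; apply/negP => h; apply: nN; exists N.
move: NN; rewrite !geq_max => /and3P[N0 /HN1/= s1 /HN2/= s2].
have [_ Nx0] := mass_gt0_le (lt_trans (expR_gt0 _) Hm).
have N0r : 0 < N%:R :> R by rewrite ltr0n.
have x0 : 0 <= x by rewrite -(pmulr_rge0 _ N0r).
have [z [/andP[_ zx] Hz]] := rate_le_mass glued N0 Nx0 (ltW Hm).
set m := (N + e N)%N in zx Hz.
have m0 : 0 < m%:R :> R by rewrite ltr0n ltn_addr.
have Nm : N%:R <= m%:R :> R by rewrite ler_nat leq_addr.
have {}Hz : rate_le z K.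
  apply: (rate_le_mono glued _ Hz); rewrite mul0r add0r normr0 addr0 -mulNr.
  rewrite ler_pdivrMr//.
  have : K * N%:R <= K * m%:R by rewrite ler_wpM2l.
  by lra.
have [zx'|xz] := leP z x.
  exists x, K; rewrite subrr normr0 (ltW d0); split=> //; first by rewrite lerDl ltW.
  rewrite -[K]add0r -[0](mulr0 x).
  by apply: (@rate_le_between z y x K 0); rewrite ?mulr0 ?add0r// zx'.
exists z, K; split => //; last by rewrite lerDl ltW.
rewrite ger0_norm ?subr_ge0 ?(ltW xz)// lerBlDr -(ler_pM2r m0) (le_trans zx)//.
have : x * N%:R <= x * m%:R by rewrite ler_wpM2l.
have : d * N%:R <= d * m%:R by rewrite ler_wpM2l// ltW.
by lra.
Qed.

Lemma rate_le_right x y K eps : rate_le y K -> y <= x -> ~ rate_le x K -> 0 < eps ->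
  \forall N \near \oo, forall B,
    mass 0 N N (N%:R * x) B <= expR (- (N%:R * (K - eps))).
Proof.
move=> Hy yx nx eps0; apply: contrapT => nlim; apply: nx.
have [y0 K0] := rate_le_ge0 glued Hy.
have x0 : 0 <= x by exact: le_trans yx.
apply: (rate_le_closed glued) => d d0.
have den0 : 0 < 1 + x by rewrite ltr_wpDr.
have [N1 _ HN1] := slack_near glued (eps := eps / 2) ltac:(lra).
have [N2 _ HN2] := slack_near glued (eps := d / (1 + x)) ltac:(by rewrite divr_gt0).
have [N NN [B Hm]] : exists2 N, (maxn 1 (maxn N1 N2) <= N)%N & exists B,
    expR (- (N%:R * (K - eps))) < mass 0 N N (N%:R * x) B.
  apply: contrapT => nN; apply: nlim; exists (maxn 1 (maxn N1 N2)) => // N NN /= B.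
  by rewrite leNgt; apply/negP => h; apply: nN; exists N => //; exists B.
move: NN; rewrite !geq_max => /and3P[N0 /HN1/= s1 /HN2/= s2].
have [NxB _] := mass_gt0_le (lt_trans (expR_gt0 _) Hm).
have N0r : 0 < N%:R :> R by rewrite ltr0n.
have [z [/andP[zx _] Hz]] := rate_le_mass glued N0 NxB (ltW Hm).
set m := (N + e N)%N in zx Hz.
have m0 : 0 < m%:R :> R by rewrite ltr0n ltn_addr.
have Nm : N%:R <= m%:R :> R by rewrite ler_nat leq_addr.
have {}Hz : rate_le z K.
  apply: (rate_le_mono glued _ Hz); rewrite mul0r add0r normr0 addr0 -mulNr.
  rewrite ler_pdivrMr//.
  have : K * N%:R <= K * m%:R by rewrite ler_wpM2l.
  by lra.
have [xz|zx'] := leP x z.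
  exists x, K; rewrite subrr normr0 (ltW d0); split=> //; first by rewrite lerDl ltW.
  rewrite -[K]add0r -[0](mulr0 x).
  by apply: (@rate_le_between y z x K 0); rewrite ?mulr0 ?add0r// yx.
exists z, K; split => //; last by rewrite lerDl ltW.
rewrite distrC ger0_norm ?subr_ge0 ?(ltW zx')// lerBlDl -lerBlDr -(ler_pM2r m0).
rewrite (le_trans _ zx)//.
have s3 : (1 + x) * (slack N)%:R <= d * N%:R.
  by rewrite -ler_pdivlMl// mulrA [_^-1 * _]mulrC.
have : x * (e N)%:R <= x * (slack N)%:R by rewrite ler_wpM2l// ler_nat le_slack.
have : d * N%:R <= d * m%:R by rewrite ler_wpM2l// ltW.
have : m%:R = N%:R + (e N)%:R :> R by rewrite natrD.
move=> mE h1 h2; rewrite mulrBl {1}mE; move: s3 h1 h2; lra.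
Qed.

Definition info_max n := \sum_(s <- words n) info s.

Lemma info_max_ge n s : size s = n -> info s <= info_max n.
Proof.
move=> sn; rewrite /info_max (bigD1_seq s) ?words_uniq ?mem_words ?sn//=.
by rewrite lerDl sumr_ge0// => t _; exact: info_ge0 glued t.
Qed.

Lemma info_max_ge0 n : 0 <= info_max n.
Proof. by apply: sumr_ge0 => s _; exact: info_ge0 glued s. Qed.

Definition partition_sum al n := \sum_(s <- words n | 0 < p s) expR (al * info s) * p s.

Lemma partition_sumE al n : partition_sum al n = mass al n n 0 (info_max n).
Proof.
rewrite /partition_sum /mass words_inn big_seq_cond [RHS]big_seq_cond; apply: eq_bigl => s.
case: (boolP (s \in words n)) => //=; rewrite mem_words => /eqP /info_max_ge ->.
by rewrite (info_ge0 glued) !andbT.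
Qed.

Lemma le_mass_partition_sum al n a b : mass al n n a b <= partition_sum al n.
Proof.
rewrite /partition_sum /mass words_inn [leLHS]big_mkcond [leRHS]big_mkcond.
apply: ler_sum => s _ /=; have f0 : 0 <= expR (al * info s) * p s.
  by rewrite mulr_ge0 ?expR_ge0//; case: wp.
by case: ltP => //= _; case: ifP.
Qed.

Lemma partition_sum0 n : partition_sum 0 n = 1.
Proof.
rewrite -(weight_words n wp) /partition_sum big_mkcond; apply: eq_bigr => s _.
rewrite mul0r expR0 mul1r; case: ltP => //.
by case: wp => _ p0 _ _ ps; apply/eqP; rewrite eq_le ps p0.
Qed.

Lemma partition_sum_gt0 al n : 0 < partition_sum al n.
Proof.
have [s sn ps] : exists2 s, s \in words n & 0 < p s.
  apply: contrapT => ns; have := partition_sum0 n; rewrite /partition_sum big1_seq.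
    by move/esym/eqP; rewrite oner_eq0.
  by move=> s /andP[ps sn]; exfalso; apply: ns; exists s.
rewrite /partition_sum big_mkcond (bigD1_seq s) ?words_uniq//= ps.
apply: ltr_wpDr; last by rewrite mulr_gt0 ?expR_gt0.
apply: sumr_ge0 => t _; case: ifP => // pt.
by rewrite mulr_ge0 ?expR_ge0// ltW.
Qed.

Lemma rate_le_partition_sum al x r eps : rate_le x r -> 0 < eps ->
  \forall N \near \oo, N%:R * (al * x - r - eps) <= ln (partition_sum al N).
Proof.
move=> Hx eps0.
have den0 : 0 < 1 + `|al| by rewrite ltr_wpDr.
pose d := eps / (1 + `|al|).
have d0 : 0 < d by rewrite divr_gt0.
have dE : d + `|al| * d = eps.
  by rewrite -[X in X + _]mul1r -mulrDl mulrC /d divfK// gt_eqF.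
have [N0 _ HN0] := Hx _ d0; exists N0 => // N /HN0 /= HN.
rewrite -ler_expR lnK ?posrE ?partition_sum_gt0//.
apply: le_trans (le_mass_partition_sum al N (N%:R * (x - d)) (N%:R * (x + d))).
apply: (@le_trans _ _ (expR (N%:R * (al * x - `|al| * d)) * expR (- (N%:R * (r + d))))).
  by rewrite -expRD ler_expR -[- (N%:R * _)]mulrN -mulrDr ler_wpM2l//; lra.
apply: (le_trans (ler_wpM2l (expR_ge0 _) HN)).
rewrite /mass mulr_sumr; apply: ler_sum => s /andP[ps /andP[s1 s2]].
rewrite mul0r expR0 mul1r ler_wpM2r// ?(ltW ps)// ler_expR.
suff : `|al * (info s - N%:R * x)| <= `|al| * (N%:R * d).
  by rewrite ler_norml => /andP[]; lra.
rewrite normrM ler_wpM2l//.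
by rewrite ler_norml; apply/andP; split; lra.
Qed.

Lemma partition_sum_rate_le al n : (0 < n)%N -> exists x,
  rate_le x (al * x -
    (ln (partition_sum al n) - (2 + `|al|) * (slack n)%:R) / (n + e n)%:R).
Proof.
move=> n0; have := info_max_ge0 n => m0.
have [|x [_ Hx]] := @rate_le_mass _ _ _ _ _ _ glued al n 0 (info_max n)
  (ln (partition_sum al n)) n0 m0; last by exists x.
by rewrite -partition_sumE lnK// posrE partition_sum_gt0.
Qed.

(** At [al = 0] the partition sums equal 1, so that the points of
    [partition_sum_rate_le] have arbitrarily small rate. *)
Lemma rate_le_small eps : 0 < eps -> exists x, rate_le x eps.
Proof.
move=> eps0.
have [N _ HN] := slack_near glued (eps := eps / 2) ltac:(lra).
have /= sl := HN N.+1 (leqnSn _).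
have [x Hx] := partition_sum_rate_le 0 (ltn0Sn N).
exists x; apply: (rate_le_mono glued _ Hx).
rewrite mul0r add0r partition_sum0 ln1 normr0 addr0 add0r -mulNr opprK.
rewrite ler_pdivrMr ?ltr0n ?ltn_addr//.
have : eps * N.+1%:R <= eps * (N.+1 + e N.+1)%:R.
  by rewrite ler_wpM2l ?(ltW eps0)// ler_nat leq_addr.
by move: sl; lra.
Qed.

Lemma rate_le_word x r eps : rate_le x r -> 0 < eps -> \forall N \near \oo,
  exists s, [/\ size s = N, 0 < p s & N%:R * (x - eps) <= info s <= N%:R * (x + eps)].
Proof.
move=> Hx eps0; have [N0 _ HN0] := Hx _ eps0; exists N0 => // N /HN0 /= HN.
apply: contrapT => ns.
have := lt_le_trans (expR_gt0 _) HN; rewrite /mass words_inn big1_seq ?ltxx//.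
move=> s /andP[/andP[ps sx]]; rewrite mem_words => /eqP sN.
by exfalso; apply: ns; exists s.
Qed.

End tails_and_sums.

(** * Words weighted by their own probability *)

Section self_information.
Context {R : realType} {A : finType} {c : nat} {e : nat -> nat}.
Context {p : seq A -> R} (glued : glued_words c e p p).
Implicit Types (w : seq A) (s a b x y z r eps : R).
Local Notation mass := (@mass R A p p).
Local Notation info := (@info R A p).
Local Notation slack := (@slack c e).
Local Notation rate_le := (@rate_le R A p p).

(** [rate_le_mass] is applied to the window that consists of the value of a
    single word. *)
Lemma word_rate_le w : 0 < p w -> (0 < size w)%N -> exists x,
  let m : R := (size w + e (size w))%:R in
  info w - (slack (size w))%:R <= x * m <= info w + (slack (size w))%:R /\
  rate_le x (x + 3 * (slack (size w))%:R / m).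
Proof.
move=> pw w0; set n := size w.
have Hm : expR (- info w) <= mass 0 n n (info w) (info w).
  rewrite /mass words_inn (bigID (pred1 w)) /= -[leLHS]addr0 lerD//; last first.
    apply: sumr_ge0 => s _; rewrite mulr_ge0 ?expR_ge0//.
    by case: (glued_weightl glued).
  rewrite -big_filter (_ : [seq _ <- _ | _] = [:: w]).
    by rewrite big_seq1 mul0r expR0 mul1r /info opprK lnK.
  apply: perm_small_eq => //; apply: uniq_perm => //.
    exact/filter_uniq/words_uniq.
  move=> s; rewrite mem_filter mem_words inE.
  by case: (eqVneq s w) => [->|_]; rewrite ?andbF// pw lexx eqxx.
have [x [/andP[x1 x2] Hx]] := rate_le_mass glued w0 (lexx _) Hm.
exists x => /=; rewrite x1 x2; split => //.
apply: (rate_le_mono glued _ Hx).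
set m := (n + e n)%N in x1 x2 *.
have m0 : 0 < m%:R :> R by rewrite ltr0n ltn_addr.
rewrite mul0r add0r normr0 addr0 -mulNr ler_pdivrMr// [leRHS]mulrDl.
rewrite divfK ?gt_eqF//.
by move: x1; rewrite -/n; lra.
Qed.

(** Words of information [s] per letter have weight [exp (- n s)], and a single
    word already realizes this rate; mixing two words interpolates. *)
Lemma rate_le_self s :
  (forall eps, 0 < eps -> forall n0, exists w, [/\ (n0 <= size w)%N, 0 < p w &
     info w <= (size w)%:R * (s + eps)]) ->
  (forall eps, 0 < eps -> forall n0, exists w, [/\ (n0 <= size w)%N, 0 < p w &
     (size w)%:R * (s - eps) <= info w]) ->
  rate_le s s.
Proof.
move=> Hlo Hhi; apply: (rate_le_closed glued) => eps eps0.
have den0 : 0 < 6 + 2 * `|s| by rewrite ltr_wpDr// mulr_ge0.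
pose d := eps / (6 + 2 * `|s|).
have d0 : 0 < d by rewrite divr_gt0.
have dE : d * 6 + d * (2 * `|s|) = eps by rewrite -mulrDr /d divfK// gt_eqF.
have ds0 : 0 <= d * `|s| by rewrite mulr_ge0// ltW.
have [N0 _ HN0] := slack_near glued d0.
have bnd w : (maxn 1 N0 <= size w)%N -> 0 < p w -> exists x, [/\
    rate_le x (x + eps / 2),
    (info w <= (size w)%:R * (s + d) -> x <= s + eps / 2) &
    ((size w)%:R * (s - d) <= info w -> s - eps <= x)].
  rewrite geq_max => /andP[w0 /HN0/= sl] pw.
  have [x [/andP[x1 x2] Hx]] := word_rate_le pw w0.
  set n := size w in w0 sl x1 x2 Hx *; set m := (n + e n)%N in x1 x2 Hx *.
  have m0 : 0 < m%:R :> R by rewrite ltr0n ltn_addr.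
  have mE : m%:R = n%:R + (e n)%:R :> R by rewrite natrD.
  have en : (e n)%:R <= d * n%:R by apply: le_trans sl; rewrite ler_nat le_slack.
  have es : `|(e n)%:R * s| <= d * n%:R * `|s|.
    by rewrite normrM ger0_norm// ler_wpM2r.
  move: es; rewrite ler_norml => /andP[es1 es2].
  have epsn : eps * n%:R = d * n%:R * 6 + 2 * (d * n%:R * `|s|) by rewrite -dE; ring.
  have epse : 0 <= eps * (e n)%:R by rewrite mulr_ge0// ltW.
  have dn0 : 0 <= d * n%:R * `|s| by rewrite !mulr_ge0// ltW.
  have dnn0 : 0 <= d * n%:R by rewrite mulr_ge0// ltW.
  exists x; split.
  - apply: (rate_le_mono glued _ Hx); rewrite lerD2l ler_pdivrMr// mE.
    by move: sl epsn epse dn0; clear -glued; lra.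
  - move=> iw; rewrite -(ler_pM2r m0) (le_trans x2)// mE.
    by move: iw sl epsn epse dn0 dnn0 es1 es2 en; clear -glued; lra.
  - move=> iw; rewrite -(ler_pM2r m0) (le_trans _ x1)// mE.
    by move: iw sl epsn epse dn0 dnn0 es1 es2 en; clear -glued; lra.
have [w1 [/bnd b1 /b1[x [Hx xs _]] w1s]] := Hlo d d0 (maxn 1 N0).
have [w2 [/bnd b2 /b2[y [Hy _ ys]] w2s]] := Hhi d d0 (maxn 1 N0).
have {}xs := xs w1s; have {}ys := ys w2s.
have [xs'|sx] := leP x s; last first.
  exists x, (x + eps / 2); split=> //; last lra.
  by rewrite ger0_norm; lra.
have [sy|ys'] := leP s y; last first.
  exists y, (y + eps / 2); split=> //; last lra.
  by rewrite ler0_norm; lra.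
exists s, (s + eps / 2); split; [|lra|].
  by rewrite subrr normr0 ltW.
rewrite -[X in X + _]mulr1; apply: (@rate_le_between _ _ _ _ _ _ glued x y).
- by rewrite xs'.
- by rewrite mulr1.
- by rewrite mulr1.
Qed.

End self_information.

(** * Limits of extended real sequences *)

Section limits.
Context {R : realType}.
Local Open Scope ereal_scope.
Implicit Types l : R.

Lemma lee_reals (u v : \bar R) : (forall l, l%:E < u -> l%:E <= v) -> u <= v.
Proof.
move=> H; rewrite leNgt; apply/negP; case: u v H => [u| |] [v| |] //= H.
- rewrite lte_fin => vu; have := H ((u + v) / 2)%R; rewrite lte_fin lee_fin.
  have -> : ((u + v) / 2 < u)%R by lra.
  by move=> /(_ isT); lra.
- by move=> _; have := H (u - 1)%R; rewrite lte_fin gtrBl ltr01 => /(_ isT).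
- by move=> _; have := H (v + 1)%R (ltry _); rewrite lee_fin; lra.
- by move=> _; have := H 0%R (ltry _).
Qed.

Lemma lee_reals_up (u v : \bar R) :
  (forall l : R, v < l%:E -> u <= l%:E) -> u <= v.
Proof.
move=> H; rewrite -leeN2; apply: lee_reals => l.
by rewrite lteNr -EFinN => /H; rewrite EFinN leeNr.
Qed.

Lemma limn_esup_le (u : nat -> \bar R) (L : \bar R) :
  (forall l : R, L < l%:E -> \forall n \near \oo, u n <= l%:E) -> limn_esup u <= L.
Proof.
move=> H; apply: lee_reals_up => l /H Hl; rewrite /limn_esup limf_esupE.
set V := [set n | u n <= l%:E]; apply: (@le_trans _ _ (ereal_sup (u @` V))).
  by apply: ereal_inf_lbound; exists V.
by apply: ge_ereal_sup => _ [n Vn <-].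
Qed.

Lemma limn_einf_ge (u : nat -> \bar R) (L : \bar R) :
  (forall l : R, l%:E < L -> \forall n \near \oo, l%:E <= u n) -> L <= limn_einf u.
Proof.
move=> H; rewrite /limn_einf leeNr; apply: limn_esup_le => l.
rewrite lteNl -EFinN => /H [N _ HN]; exists N => // n /HN /=.
by rewrite EFinN leeNl.
Qed.

Lemma limn_esup_gt (u : nat -> \bar R) l : l%:E < limn_esup u ->
  forall n0, exists2 n, (n0 <= n)%N & l%:E < u n.
Proof.
move=> lu n0; apply: contrapT => nn; move: lu; apply/negP; rewrite -leNgt.
apply: limn_esup_le => l' ll'; exists n0 => // n /= n0n.
apply: (@le_trans _ _ l%:E); last exact: ltW.
by rewrite leNgt; apply/negP => lu; apply: nn; exists n.
Qed.

Lemma limn_einf_lt (u : nat -> \bar R) l : limn_einf u < l%:E ->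
  forall n0, exists2 n, (n0 <= n)%N & u n < l%:E.
Proof.
move=> lu n0; apply: contrapT => nn; move: lu; apply/negP; rewrite -leNgt.
apply: limn_einf_ge => l' ll'; exists n0 => // n /= n0n.
apply: (@le_trans _ _ l%:E); first exact: ltW.
by rewrite leNgt; apply/negP => lu; apply: nn; exists n.
Qed.

Lemma limn_esup_lt (u : nat -> \bar R) l : limn_esup u < l%:E -> \forall n \near \oo, u n <= l%:E.
Proof.
rewrite /limn_esup limf_esupE => /ereal_inf_lt[_ [V [N _ NV] <-] Vl].
exists N => // n /NV Vn; apply: le_trans (ltW Vl).
by apply: ereal_sup_ubound; exists n.
Qed.

Lemma limn_einf_gt (u : nat -> \bar R) l : l%:E < limn_einf u -> \forall n \near \oo, l%:E <= u n.
Proof.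
rewrite /limn_einf lteNr -EFinN => /limn_esup_lt[N _ HN].
by exists N => // n /HN /=; rewrite EFinN leeN2.
Qed.

Lemma cvg_limn_esup (u : nat -> \bar R) : limn_esup u <= limn_einf u ->
  u @ \oo --> limn_esup u /\ u @ \oo --> limn_einf u.
Proof.
move=> ul; have E : limn_esup u = limn_einf u.
  by apply/eqP; rewrite eq_le ul limn_einf_sup.
suff : u @ \oo --> limn_esup u by rewrite -E.
apply: (@squeeze_cvge _ _ _ _ (einfs u) _ (esups u)).
- apply: nearW => n; apply/andP; split.
    by apply: ereal_inf_lbound; exists n => /=.
  by apply: ereal_sup_ubound; exists n => /=.
- by rewrite E limn_einf_lim; exact: is_cvg_einfs.
- by rewrite limn_esup_lim; exact: is_cvg_esups.
Qed.

Lemma cvg_EFin_lim (u : nat -> R) (L : \bar R) : -oo < L ->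
  (forall l, l%:E < L -> \forall n \near \oo, (l <= u n)%R) ->
  (forall l eps, L <= l%:E -> (0 < eps)%R -> \forall n \near \oo, (u n <= l + eps)%R) ->
  (fun n => (u n)%:E) @ \oo --> L.
Proof.
case: L => [l| |] //= _ lo hi; last first.
  by apply/cvgeyPge => M; have := lo M (ltry _).
apply: cvg_EFin; first exact: nearW.
apply/cvgrPdist_le => eps e0.
have [N1 _ h1] := lo (l - eps)%R ltac:(by rewrite lte_fin gtrBl).
have [N2 _ h2] := hi l eps (lexx _) e0.
exists (maxn N1 N2) => // n /=; rewrite geq_max => /andP[/h1/= n1 /h2/= n2].
by rewrite ler_norml; apply/andP; split; lra.
Qed.

End limits.

(** * Legendre transforms of nonnegative functions *)

Section legendre_transform.
Context {R : realType}.
Local Open Scope ereal_scope.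
Implicit Types (f g : R -> \bar R) (a b c r s x y t al : R).

Lemma legendre_ge f al s r : f s <= r%:E -> (al * s - r)%R%:E <= legendre f al.
Proof.
move=> fr; apply: (@le_trans _ _ ((al * s)%R%:E - f s)); last first.
  by apply: ereal_sup_ubound; exists s.
by rewrite EFinB leeB.
Qed.

Lemma legendre_le f al c : (forall s, 0 <= f s) ->
  (forall s r, f s <= r%:E -> (al * s - r <= c)%R) -> legendre f al <= c%:E.
Proof.
move=> f0 H; apply: ge_ereal_sup => _ [s _ <-].
have := f0 s; case E : (f s) => [r| |] //= _; last by rewrite leNye.
by rewrite -EFinB lee_fin H// E.
Qed.

Lemma ereal_convex_fin g : (forall x, -oo < g x) ->
  (forall t x y a b, (0 < t < 1)%R -> g x <= a%:E -> g y <= b%:E ->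
     g (t * x + (1 - t) * y)%R <= (t * a + (1 - t) * b)%R%:E) ->
  ereal_convex g.
Proof.
move=> g0 H t x y t01; have /andP[t0 t1] := t01.
have t'0 : (0 < 1 - t)%R by rewrite subr_gt0.
have := H t x y; have := g0 x; have := g0 y.
case: (g x) => [a| |]; case: (g y) => [b| |] //= _ _ Hab.
- by rewrite -!EFinM -EFinD; apply: Hab.
- by rewrite gt0_muley ?lte_fin// addey ?leey.
- by rewrite gt0_muley ?lte_fin// addye ?leey.
- by rewrite !gt0_muley ?lte_fin// addey ?leey.
Qed.

Lemma legendre_gtNy f al : (exists s r, f s <= r%:E) -> -oo < legendre f al.
Proof.
by move=> [s [r fr]]; apply: lt_le_trans (legendre_ge al fr); rewrite ltNyr.
Qed.

Lemma legendre_convex f : (forall s, 0 <= f s) -> (exists s r, f s <= r%:E) ->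
  ereal_convex (legendre f).
Proof.
move=> f0 fin; apply: ereal_convex_fin => [x|t x y a b /andP[t0 t1] xa yb].
  exact: legendre_gtNy.
apply: legendre_le => // s r fr.
have := le_trans (legendre_ge x fr) xa; have := le_trans (legendre_ge y fr) yb.
rewrite !lee_fin => h1 h2.
have : (t * (x * s - r) <= t * a)%R by rewrite ler_wpM2l// ltW.
have : ((1 - t) * (y * s - r) <= (1 - t) * b)%R by rewrite ler_wpM2l//; lra.
by lra.
Qed.

Lemma legendre_lsc f : (forall s, 0 <= f s) -> lower_semicontinuous (legendre f).
Proof.
move=> f0 x a /ereal_sup_gt[_ [s _ <-]].
have := f0 s; case E : (f s) => [r| |] //= _.
rewrite -EFinB lte_fin => axs.
pose d := ((x * s - r - a) / (`|s| + 1))%R.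
have den0 : (0 < `|s| + 1)%R by rewrite ltr_wpDl.
have d0 : (0 < d)%R by rewrite divr_gt0// subr_gt0.
exists (ball x d); first exact: nbhsx_ballx.
move=> y; rewrite /ball /= => xy.
apply: (@lt_le_trans _ _ (y * s - r)%R%:E); last by apply: legendre_ge; rewrite E.
rewrite lte_fin.
have : (`|(x - y) * s| < d * (`|s| + 1))%R.
  rewrite normrM; apply: (@le_lt_trans _ _ (d * `|s|)%R).
    by rewrite ler_wpM2r// ltW.
  by rewrite ltr_pM2l// ltrDl.
rewrite /d divfK ?gt_eqF// => /(le_lt_trans (ler_norm _)); lra.
Qed.

Lemma legendre_homo f : (forall s, 0 <= f s) ->
  (forall s, (s < 0)%R -> f s = +oo) ->
  {homo legendre f : a b / (a <= b)%R >-> a <= b}.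
Proof.
move=> f0 fy a b ab; apply: ge_ereal_sup => _ [s _ <-].
have [s0|/fy ->] := leP 0%R s; last by rewrite leNye.
apply: (@le_trans _ _ ((b * s)%R%:E - f s)).
  by rewrite leeB// lee_fin ler_wpM2r.
by apply: ereal_sup_ubound; exists s.
Qed.

(** Existence of a supporting line at height [c < f x0]: the slopes of the chords
    from [(x0, c)] to the graph on the left of [x0] stay below those on the right.
    Nonnegativity and lower semicontinuity bound the chord slopes. *)
Lemma supporting_line f x0 c : (forall s, 0 <= f s) -> lower_semicontinuous f ->
  ereal_convex f -> c%:E < f x0 ->
  exists al, forall s, (c + al * (s - x0))%R%:E <= f s.
Proof.
move=> f0 lsc cvx cx0; have [V Vx0 VP] := lsc _ _ cx0.
have /nbhs_ballP[d /= d0 dV] := Vx0.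
have M0 : (0 <= `|c| / d)%R by rewrite divr_ge0// ltW.
set M := (`|c| / d)%R in M0.
pose S : set R := [set v | v = (- M)%R \/ exists s r,
  [/\ (s < x0)%R, f s <= r%:E & v = ((c - r) / (x0 - s))%R]].
have near_x0 s r : f s <= r%:E -> (`|x0 - s| < d)%R -> (c < r)%R.
  by move=> fr sd; rewrite -lte_fin (lt_le_trans _ fr)//; apply/VP/dV.
have r_ge0 s r : f s <= r%:E -> (0 <= r)%R.
  by move=> fr; rewrite -lee_fin (le_trans _ fr).
have chord s r : f s <= r%:E -> s != x0 -> (c - r <= M * `|x0 - s|)%R.
  move=> fr sx; have [dle|sd] := leP d `|x0 - s|%R; last first.
    have := near_x0 _ _ fr sd; have : (0 <= M * `|x0 - s|)%R by rewrite mulr_ge0.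
    by lra.
  have h1 : (M * d <= M * `|x0 - s|)%R by rewrite ler_wpM2l.
  have h2 : (M * d = `|c|)%R by rewrite divfK// gt_eqF.
  by have := ler_norm c; have := r_ge0 _ _ fr; lra.
have left s r : (s < x0)%R -> f s <= r%:E -> ((c - r) / (x0 - s) <= M)%R.
  move=> sx fr; rewrite ler_pdivrMr ?subr_gt0//.
  have := chord s r fr; rewrite lt_eqF// => /(_ isT).
  by rewrite gtr0_norm// subr_gt0.
have right z r' v : (x0 < z)%R -> f z <= r'%:E -> S v ->
    (v <= (r' - c) / (z - x0))%R.
  move=> xz fz; rewrite ler_pdivlMr ?subr_gt0// => -[->|[s [r [sx fr ->]]]].
    have := chord z r' fz; rewrite gt_eqF// => /(_ isT).
    by rewrite distrC gtr0_norm ?subr_gt0//; lra.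
  rewrite mulrAC ler_pdivrMr ?subr_gt0//.
  have zs : (0 < z - s)%R by lra.
  pose t := ((z - x0) / (z - s))%R.
  have tE : (t * (z - s) = z - x0)%R by rewrite divfK// gt_eqF.
  have t0 : (0 < t)%R by rewrite divr_gt0//; lra.
  have t1 : (t < 1)%R by rewrite ltr_pdivrMr//; lra.
  have := cvx t s z; rewrite t0 t1 => /(_ isT).
  have -> : (t * s + (1 - t) * z = x0)%R by lra.
  move=> fx0.
  have : c%:E < (t * r + (1 - t) * r')%R%:E.
    apply: (lt_le_trans cx0); apply: (le_trans fx0).
    rewrite [leRHS]EFinD !EFinM; apply: leeD; rewrite lee_pmul2l// lte_fin.
    by lra.
  rewrite lte_fin => crr.
  have : (0 <= (z - s) * (t * r + (1 - t) * r' - c))%R.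
    by rewrite mulr_ge0 ?ltW//; lra.
  have E1 : ((z - s) * t = z - x0)%R by rewrite mulrC.
  have -> : ((z - s) * (t * r + (1 - t) * r' - c) =
    ((z - s) * t) * r + ((z - s) - (z - s) * t) * r' - (z - s) * c)%R by ring.
  by rewrite E1; lra.
have Sne : S !=set0 by exists (- M)%R; left.
have Sub : has_ubound S.
  exists M => _ [->|[s [r [sx fr ->]]]]; last exact: left.
  by lra.
exists (sup S) => s; have := f0 s; case E : (f s) => [r| |] //= _; last first.
  by rewrite leey.
rewrite lee_fin; have fr : f s <= r%:E by rewrite E.
case: (ltgtP s x0) => [sx|xs|sx].
- have : ((c - r) / (x0 - s) <= sup S)%R.
    by apply: (ub_le_sup Sub); right; exists s, r.
  by rewrite ler_pdivrMr ?subr_gt0//; lra.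
- have : (sup S <= (r - c) / (s - x0))%R.
    by apply: ge_sup => // v Sv; exact: right Sv.
  by rewrite ler_pdivlMr ?subr_gt0//; lra.
- rewrite sx subrr mulr0 addr0 -lee_fin -E sx; exact: ltW.
Qed.

(** The Fenchel-Moreau theorem in dimension one, from supporting lines at all
    heights below [f x]. *)
Lemma legendreK f : (forall s, 0 <= f s) -> lower_semicontinuous f ->
  ereal_convex f -> forall s, f s = legendre (legendre f) s.
Proof.
move=> f0 lsc cvx x; apply/eqP; rewrite eq_le; apply/andP; split.
  apply: lee_reals => c cx.
  have [al Hal] := supporting_line f0 lsc cvx cx.
  have Lal : legendre f al <= (al * x - c)%R%:E.
    apply: legendre_le => // s r fr.
    by have := le_trans (Hal s) fr; rewrite lee_fin; lra.
  have := legendre_ge x Lal; apply: le_trans.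
  by rewrite lee_fin mulrC; lra.
apply: ge_ereal_sup => _ [al _ <-].
have := f0 x; case E : (f x) => [r| |] //= _; last by rewrite leey.
have : (al * x - r)%:E <= legendre f al by apply: legendre_ge; rewrite E.
case: (legendre f al) => [l| |] //=.
- by rewrite -EFinB !lee_fin mulrC; lra.
- by rewrite /= addeNy leNye.
Qed.

End legendre_transform.

(** * The rate function and the pressure *)

Section rate_function.
Context {R : realType} {A : finType} {c : nat} {e : nat -> nat}.
Context {p q : seq A -> R} (glued : glued_words c e p q).
Local Open Scope ereal_scope.
Implicit Types (w : seq A) (s a b x y z r eps : R).
Local Notation slack := (@slack c e).
Local Notation rate_le := (@rate_le R A p q).
Local Notation partition_sum := (@partition_sum R A p q).

Definition rate x : \bar R := ereal_inf [set r%:E | r in [set r | rate_le x r]].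

(** The infimum that defines the rate is attained, by [rate_le_closed]. *)
Lemma rate_leP x r : rate x <= r%:E <-> rate_le x r.
Proof.
split=> [xr|xr]; last by apply: ereal_inf_lbound; exists r.
apply: (rate_le_closed glued) => eps e0.
have : rate x < (r + eps)%:E by apply: (le_lt_trans xr); rewrite lte_fin ltrDl.
move=> /ereal_inf_lt[_ [r' /= Hr' <-]]; rewrite lte_fin => /ltW r'r.
by exists x, r'; rewrite subrr normr0 (ltW e0).
Qed.

Lemma rate_ge0 x : 0 <= rate x.
Proof.
apply: le_ereal_inf_tmp => _ [r /= Hr <-].
by rewrite lee_fin; have [] := rate_le_ge0 glued Hr.
Qed.

Lemma rate_lt0 x : (x < 0)%R -> rate x = +oo.
Proof.
move=> x0; rewrite /rate (_ : [set _ | _ in _] = set0) ?ereal_inf0//.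
apply/seteqP; split=> // _ [r /= Hr _].
by have [] := rate_le_ge0 glued Hr; rewrite leNgt x0.
Qed.

Lemma rate_lsc : lower_semicontinuous rate.
Proof.
move=> x a ax; apply: contrapT => nV.
move: ax; rewrite ltNge => /negP; apply; apply/rate_leP.
apply: (rate_le_closed glued) => eps e0.
apply: contrapT => ny; apply: nV; exists (ball x eps); first exact: nbhsx_ballx.
move=> y; rewrite /ball/= => xy; rewrite ltNge; apply/negP => /rate_leP Hy.
apply: ny; exists y, a; split => //; first by rewrite distrC ltW.
by rewrite lerDl ltW.
Qed.

Lemma rate_convex : ereal_convex rate.
Proof.
apply: ereal_convex_fin => [x|t x y a b t01 /rate_leP Hx /rate_leP Hy].
  exact: lt_le_trans (ltNyr 0) (rate_ge0 x).
exact/rate_leP/(rate_le_convex glued).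
Qed.

Lemma rate_fin : exists s r, rate s <= r%:E.
Proof.
by have [x Hx] := rate_le_small glued (@ltr01 R); exists x, 1%R; apply/rate_leP.
Qed.

Lemma legendre_rate0 : legendre rate 0%R = 0.
Proof.
apply/eqP; rewrite eq_le; apply/andP; split.
  apply: legendre_le; first exact: rate_ge0.
  move=> s r /rate_leP Hr; rewrite mul0r add0r oppr_le0.
  by have [] := rate_le_ge0 glued Hr.
apply: lee_reals => l; rewrite lte_fin => l0.
have [x /rate_leP Hx] := rate_le_small glued (eps := (- l)%R) ltac:(lra).
by have := legendre_ge 0%R Hx; rewrite mul0r add0r opprK.
Qed.

(** The exponential growth rate of the partition sums is the Legendre transform
    of the rate function: [rate_le_partition_sum] and [partition_sum_rate_le] are the two
    inequalities. *)
Lemma partition_sum_cvg al : (fun n => (n%:R^-1 * ln (partition_sum al n))%:E) @ \oo -->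
  legendre rate al.
Proof.
apply: cvg_EFin_lim.
- exact: legendre_gtNy rate_fin.
- move=> l /ereal_sup_gt[_ [s _ <-]].
  case E : (rate s) (rate_ge0 s) => [r| |] //= _.
  rewrite -EFinB lte_fin => ls.
  have /rate_leP Hs : rate s <= r%:E by rewrite E.
  have d0 : (0 < al * s - r - l)%R by lra.
  have [N0 _ HN] := rate_le_partition_sum glued al Hs d0.
  exists N0.+1 => // N /= N0N; have := HN N (ltnW N0N).
  have N0' : (0 < N%:R :> R)%R by rewrite ltr0n (leq_trans _ N0N).
  by rewrite ler_pdivlMl//=; lra.
- move=> l eps Ll e0.
  pose d := (eps / (3 + `|al| + `|l|))%R.
  have den0 : (0 < 3 + `|al| + `|l|)%R by rewrite -addrA ltr_wpDr// addr_ge0.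
  have d0 : (0 < d)%R by rewrite divr_gt0.
  have dE : (d * 3 + d * `|al| + d * `|l| = eps)%R.
    by rewrite -!mulrDr /d divfK// gt_eqF.
  have [N0 _ HN0] := slack_near glued d0.
  exists N0.+1 => // N /= N0N; have /= sl := HN0 N (ltnW N0N).
  have N0' : (0 < N)%N by exact: leq_trans N0N.
  have [x /rate_leP Hx] := partition_sum_rate_le glued al N0'.
  have := le_trans (legendre_ge al Hx) Ll; rewrite lee_fin opprB addrCA subrr addr0.
  have Nr0 : (0 < N%:R :> R)%R by rewrite ltr0n.
  have m0 : (0 < (N + e N)%:R :> R)%R by rewrite ltr0n ltn_addr.
  rewrite ler_pdivrMr// ler_pdivrMl// natrD.
  have en : ((e N)%:R <= d * N%:R)%R by apply: le_trans sl; rewrite ler_nat le_slack.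
  have : (`|(e N)%:R * l| <= d * N%:R * `|l|)%R by rewrite normrM ger0_norm// ler_wpM2r.
  rewrite ler_norml => /andP[_ h1] h2.
  have h3 : (`|al| * (slack N)%:R <= `|al| * (d * N%:R))%R by rewrite ler_wpM2l.
  have h4 : (eps * N%:R = d * N%:R * 3 + d * N%:R * `|al| + d * N%:R * `|l|)%R.
    by rewrite -dE; ring.
  have h5 : (0 <= d * N%:R)%R by rewrite mulr_ge0// ltW.
  by move: h1 h2 h3 h4 h5 sl; clear -glued; lra.
Qed.

End rate_function.

(** * Large deviation estimates for words *)

Lemma closure_inf (R : realType) (S : set R) :
  S !=set0 -> has_lbound S -> closure S (inf S).
Proof.
move=> S0 lS B /nbhs_ballP[d /= d0 dB].
have [z Sz zd] := inf_adherent d0 (conj S0 lS).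
exists z; split => //; apply: dB; rewrite /ball /= distrC ger0_norm.
  by rewrite ltrBlDl.
by rewrite subr_ge0; exact: ge_inf.
Qed.

Section events.
Context {R : realType} {A : finType} {c : nat} {e : nat -> nat}.
Context {p q : seq A -> R} (glued : glued_words c e p q).
Implicit Types (w : seq A) (s a b x y z r eps : R) (S F : set R).
Local Notation mass := (@mass R A p q).
Local Notation info := (@info R A q).
Local Notation rate_le := (@rate_le R A p q).

Definition event_mass N S : R :=
  \sum_(w <- words N | (0 < p w) && `[< S (N%:R^-1 * info w) >]) p w.

Lemma event_le N S (P : pred (seq A)) :
  (forall w, size w = N -> 0 < p w -> S (N%:R^-1 * info w) -> P w) ->
  event_mass N S <= \sum_(w <- words N | (0 < p w) && P w) p w.
Proof.
move=> H; rewrite /event_mass big_mkcond [leRHS]big_mkcond /= big_seq [leRHS]big_seq.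
apply: ler_sum => w; rewrite mem_words => /eqP wN.
case: ltP => //= pw; case: asboolP => [/(H _ wN pw) ->//|_].
by case: ifP => // _; exact: ltW.
Qed.

Lemma mass0E N a b :
  mass 0 N N a b = \sum_(w <- words N | (0 < p w) && (a <= info w <= b)) p w.
Proof.
rewrite /mass words_inn; apply: eq_bigr => w _.
by rewrite mul0r expR0 mul1r.
Qed.

Lemma mass_le_event N a b S :
  (forall w, size w = N -> a <= info w <= b -> S (N%:R^-1 * info w)) ->
  mass 0 N N a b <= event_mass N S.
Proof.
move=> H; rewrite mass0E /event_mass big_mkcond [leRHS]big_mkcond /= big_seq [leRHS]big_seq.
apply: ler_sum => w; rewrite mem_words => /eqP wN.
case: ltP => //= pw; case: ifP => [/(H _ wN) Sw|_].
  by case: asboolP.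
by case: ifP => // _; exact: ltW.
Qed.

Lemma event_split N S x :
  event_mass N S <= event_mass N (S `&` [set y | y <= x]) + event_mass N (S `&` [set y | x <= y]).
Proof.
rewrite /event_mass big_mkcond [X in _ <= X + _]big_mkcond [X in _ <= _ + X]big_mkcond.
rewrite -big_split; apply: ler_sum => w _ /=.
case: (ltP 0 (p w)) => /= [pw|_]; last by rewrite addr0.
have pw0 := ltW pw.
case: (asboolP (S _)) => [Sw|_]; last by rewrite addr_ge0//; case: ifP.
case: (leP (N%:R^-1 * info w) x) => [h|/ltW h].
  rewrite [X in _ <= X + _]ifT; last exact/asboolP.
  by rewrite lerDl; case: ifP.
rewrite [X in _ <= _ + X]ifT; last exact/asboolP.
by rewrite lerDr; case: ifP.
Qed.

Lemma event_open S x r eps : open S -> S x -> rate_le x r -> 0 < eps ->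
  \forall N \near \oo, expR (- (N%:R * (r + eps))) <= event_mass N S.
Proof.
move=> oS Sx Hx e0.
have /nbhs_ballP[d /= d0 dS] : nbhs x S by exact: open_nbhs_nbhs.
pose d' := Num.min (d / 2) eps.
have d'0 : 0 < d' by rewrite lt_min divr_gt0.
have d'd : d' < d.
  by apply: (@le_lt_trans _ _ (d / 2)); [rewrite ge_min lexx|lra].
have d'e : d' <= eps by rewrite ge_min lexx orbT.
have [N0 _ HN] := Hx _ d'0; exists N0.+1 => // N /= N0N.
have N1 : 0 < N%:R :> R by rewrite ltr0n (leq_trans _ N0N).
have := HN N (ltnW N0N) => /= {}HN.
apply: (@le_trans _ _ (expR (- (N%:R * (r + d'))))).
  by rewrite ler_expR lerN2 ler_wpM2l// lerD2l.
apply: (le_trans HN); apply: mass_le_event => w _ /andP[w1 w2].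
apply: dS; rewrite /ball /=; apply: le_lt_trans d'd.
rewrite ler_norml; move: w1; rewrite -ler_pdivlMl// => w1.
move: w2; rewrite -ler_pdivrMl// => w2.
by apply/andP; split; lra.
Qed.

Lemma event_left F y K eps : closed F -> (forall x, F x -> ~ rate_le x K) ->
  rate_le y K -> 0 < eps -> \forall N \near \oo,
  event_mass N (F `&` [set x | x <= y]) <= expR (- (N%:R * (K - eps))).
Proof.
move=> cF nF Hy e0; set G := F `&` _.
have [[z Gz]|G0] := pselect (G !=set0); last first.
  near=> N; rewrite (le_trans (event_le (P := pred0) _))//.
    by move=> w _ _ Gw; exfalso; apply: G0; eexists; exact: Gw.
  by rewrite big_pred0 ?expR_ge0// => w; rewrite andbF.
have Gub : has_ubound G by exists y => x [].
have [Fs sy] : G (sup G).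
  have /closure_id GE : closed G by apply: closedI => //; exact: closed_le.
  by rewrite {1}GE; exact: (closure_sup (ex_intro _ z Gz) Gub).
have [N0 _ HN] := rate_le_left glued Hy sy (nF _ Fs) e0.
exists N0.+1 => // N /= N0N; apply: le_trans (HN N (ltnW N0N)).
have N1 : 0 < N%:R :> R by rewrite ltr0n (leq_trans _ N0N).
rewrite mass0E; apply: event_le => w _ _ Gw.
rewrite (info_ge0 glued) -ler_pdivrMl//.
by apply: (ub_le_sup Gub); exact: Gw.
Unshelve. all: by end_near. Qed.

Lemma event_right F y K eps : closed F -> (forall x, F x -> ~ rate_le x K) ->
  rate_le y K -> 0 < eps -> \forall N \near \oo,
  event_mass N (F `&` [set x | y <= x]) <= expR (- (N%:R * (K - eps))).
Proof.
move=> cF nF Hy e0; set G := F `&` _.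
have [[z Gz]|G0] := pselect (G !=set0); last first.
  near=> N; rewrite (le_trans (event_le (P := pred0) _))//.
    by move=> w _ _ Gw; exfalso; apply: G0; eexists; exact: Gw.
  by rewrite big_pred0 ?expR_ge0// => w; rewrite andbF.
have Glb : has_lbound G by exists y => x [].
have [Fs sy] : G (inf G).
  have /closure_id GE : closed G by apply: closedI => //; exact: closed_ge.
  by rewrite {1}GE; exact: (closure_inf (ex_intro _ z Gz) Glb).
have [N0 _ HN] := rate_le_right glued Hy sy (nF _ Fs) e0.
exists N0.+1 => // N /= N0N; have {}HN := HN N (ltnW N0N) (@info_max R A q N).
apply: le_trans HN.
have N1 : 0 < N%:R :> R by rewrite ltr0n (leq_trans _ N0N).
rewrite mass0E; apply: event_le => w wN _ Gw.
rewrite (info_max_ge glued wN) andbT -ler_pdivlMl//.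
by apply: (ge_inf Glb); exact: Gw.
Unshelve. all: by end_near. Qed.

(** The level set of [K] is an interval disjoint from [F]; the parts of [F] on
    either side of one of its points are tails beyond the nearest point of [F]. *)
Lemma event_closed F K eps : closed F -> 0 < K -> (forall x, F x -> ~ rate_le x K) ->
  0 < eps -> \forall N \near \oo, event_mass N F <= 2 * expR (- (N%:R * (K - eps))).
Proof.
move=> cF K0 nF e0; have [y Hy] := rate_le_small glued K0.
have h1 := event_left cF nF Hy e0; have h2 := event_right cF nF Hy e0.
near=> N; apply: le_trans (event_split N F y) _.
by rewrite mulrDl mul1r lerD//; near: N.
Unshelve. all: by end_near. Qed.

Lemma event_le1 N S : event_mass N S <= 1.
Proof.
rewrite -(weight_words N (glued_weightl glued)) /event_mass big_mkcond.
apply: ler_sum => w _; case: ifP => // _.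
by case: (glued_weightl glued).
Qed.

End events.

(** * Measures on the full shift as weights on words *)

Section word_probabilities.
Context {R : realType} {A : finPointedType}.
Implicit Types (P Q : probability (full_shift A) R) (n : nat) (s : seq A).

Definition cyl s : set (full_shift A) := [set x | mkseq x (size s) = s].

Lemma val_prefix n (x : full_shift A) : val (prefix n x) = mkseq x n.
Proof. by rewrite /mkseq -val_enum_ord -map_comp. Qed.

Lemma cylinderE n (u : n.-tuple A) : cylinder u = cyl u.
Proof.
rewrite /cylinder /cyl size_tuple; apply/seteqP; split=> x /=.
  by move=> <-; rewrite -val_prefix.
by move=> xu; apply/val_inj; rewrite val_prefix.
Qed.

Lemma measurable_coord k (a : A) : measurable [set x : full_shift A | x k = a].
Proof.
apply: sub_sigma_algebra.
have /continuousP cont : continuous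
    (proj k : prod_topology (fun _ : nat => discrete_topology A) ->
      discrete_topology A).
  by move=> x; exact: proj_continuous.
exact: (cont [set a] (discrete_open _)).
Qed.

Lemma measurable_cyl s : measurable (cyl s).
Proof.
elim/last_ind: s => [|s a IH].
  by rewrite (_ : cyl _ = setT) //; apply/seteqP; split.
rewrite (_ : cyl _ = cyl s `&` [set x | x (size s) = a]).
  exact: measurableI IH (measurable_coord _ _).
apply/seteqP; split=> x; rewrite /cyl /= size_rcons mkseqS.
  by move=> /rcons_inj[].
by move=> [-> ->].
Qed.

Lemma prefix_seq_measure P n (r : seq (seq A)) :
  uniq r -> all (fun s => size s == n) r ->
  measurable [set x : full_shift A | mkseq x n \in r] /\
  P [set x : full_shift A | mkseq x n \in r] = (\sum_(s <- r) P (cyl s))%E.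
Proof.
elim: r => [|s r IH] /=.
  move=> _ _; rewrite big_nil (_ : [set _ | _] = set0) ?measure0; last first.
    by apply/seteqP; split.
  by split; first exact: measurable0.
move=> /andP[sr ur] /andP[/eqP sn rn]; have [mr Pr] := IH ur rn.
rewrite (_ : [set x : full_shift A | _] = cyl s `|` [set x | mkseq x n \in r]).
  split; first exact: measurableU (measurable_cyl s) mr.
  rewrite big_cons -Pr measureU//; first exact: measurable_cyl.
  apply/seteqP; split => // x [] /=; rewrite /cyl /= sn => ->.
  by apply/negP.
apply/seteqP; split=> x; rewrite /cyl /= sn inE.
  by move=> /orP[/eqP|]; [left|right].
by move=> [->|->]; rewrite ?eqxx ?orbT.
Qed.

Lemma measurable_prefix n (B : seq A -> Prop) :
  measurable [set x : full_shift A | B (mkseq x n)].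
Proof.
have [||+ _] := @prefix_seq_measure (dirac (point : full_shift A)) n
  [seq s <- words n | `[< B s >]].
- exact/filter_uniq/words_uniq.
- by apply/allP => s; rewrite mem_filter mem_words => /andP[].
congr (measurable _); apply/seteqP; split=> x /=;
  rewrite mem_filter mem_words size_mkseq eqxx andbT.
  by move=> /asboolP.
by move=> ?; exact/asboolP.
Qed.

Definition wprob P s : R := fine (P (cyl s)).

Lemma wprobE P s : (wprob P s)%:E = P (cyl s).
Proof. by rewrite fineK// fin_num_measure//; exact: measurable_cyl. Qed.

Lemma word_probE P n (u : n.-tuple A) : word_prob P u = wprob P u.
Proof. by rewrite /word_prob cylinderE. Qed.

(** Every event used below is determined by finitely many letters, and its
    probability is a sum over words. *)
Lemma prefix_prob P n (B : seq A -> Prop) :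
  P [set x : full_shift A | B (mkseq x n)] =
  (\sum_(s <- words n | `[< B s >]) wprob P s)%:E.
Proof.
have [||_] := @prefix_seq_measure P n [seq s <- words n | `[< B s >]].
- exact/filter_uniq/words_uniq.
- by apply/allP => s; rewrite mem_filter mem_words => /andP[].
rewrite big_filter => E; rewrite -sumEFin.
under [RHS]eq_bigr do rewrite wprobE; rewrite -E; congr (P _).
apply/seteqP; split=> x /=; rewrite mem_filter mem_words size_mkseq eqxx andbT.
  by move=> ?; exact/asboolP.
by move=> /asboolP.
Qed.

Lemma wprob_ge0 P s : 0 <= wprob P s.
Proof. by rewrite fine_ge0. Qed.

Lemma wprob_weight P : shift_invariant P -> word_weight (wprob P).
Proof.
move=> inv; split; last 2 first.
- move=> s; apply: EFin_inj; rewrite wprobE.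
  have -> : cyl s = [set x | take (size s) (mkseq x (size s).+1) = s].
    apply/seteqP; split=> x; rewrite /cyl /= mkseqS -cats1 take_cat size_mkseq ltnn;
    by rewrite subnn take0 cats0.
  rewrite (prefix_prob P _ (fun t => take (size s) t = s)); congr EFin.
  rewrite -[RHS]big_filter (perm_big [seq rcons s a | a <- enum A]).
    by rewrite big_map big_enum.
  apply: uniq_perm; first exact/filter_uniq/words_uniq.
    by rewrite map_inj_uniq ?enum_uniq// => a b /rcons_inj[].
  move=> t; rewrite mem_filter mem_words; apply/andP/mapP.
    move=> [/asboolP ts /eqP tn]; case/lastP: t ts tn => // t a.
    rewrite size_rcons => ts [] tn; exists a; first by rewrite mem_enum.
    by congr rcons; rewrite -[RHS]ts -cats1 -tn take_size_cat.
  move=> [a _ ->]; rewrite size_rcons; split=> //; apply/asboolP.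
  by rewrite -cats1 take_size_cat.
- move=> s; apply: EFin_inj; rewrite wprobE -inv; last exact: measurable_cyl.
  have -> : shift @^-1` (cyl s) =
      [set x : full_shift A | behead (mkseq x (size s).+1) = s].
    have E (x : full_shift A) n : behead (mkseq x n.+1) = mkseq (shift x) n.
      by rewrite /mkseq /= (iotaDl 1 0) -map_comp.
    by apply/seteqP; split=> x; rewrite /cyl /=; have /= -> := E x (size s).
  rewrite (prefix_prob P _ (fun t => behead t = s)); congr EFin.
  rewrite [RHS]big_mkcond /= big_allpairs_dep big_enum /=; apply: eq_bigr => a _.
  rewrite (bigD1_seq s) ?words_uniq ?mem_words//= asboolT// big1 ?addr0// => t ts.
  by rewrite asboolF//; exact/eqP.
- by apply: EFin_inj; rewrite wprobE (_ : cyl [::] = setT) ?probability_setT//;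
    apply/seteqP; split.
- exact: wprob_ge0.
Qed.

Lemma big_tuple_words n (B : pred (seq A)) (F : seq A -> R) :
  \sum_(u : n.-tuple A | B u) F u = \sum_(s <- words n | B s) F s.
Proof.
rewrite -(big_map val B F); apply: perm_big.
apply: uniq_perm; last 2 first.
- exact: words_uniq.
- move=> s; rewrite mem_words; apply/mapP/eqP => [[u _ ->]|sn].
    by rewrite size_tuple.
  by exists (Tuple (introT eqP sn)); rewrite ?mem_index_enum.
- by rewrite map_inj_uniq ?index_enum_uniq//; exact: val_inj.
Qed.

End word_probabilities.

(** * Admissible pairs of measures *)

Section admissible_pairs.
Context {R : realType} {A : finPointedType}.
Context {P Q : probability (full_shift A) R} {tau : nat -> nat} {C : nat -> R}.

Lemma admissible_decoupled : decoupling_rates tau C ->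
  shift_invariant P -> shift_invariant Q -> admissible tau C P Q ->
  decoupled_words tau C (wprob P) (wprob Q).
Proof.
move=> [C1 tau0 C0] invP invQ [ac _ ud sld]; split.
- exact: wprob_weight.
- exact: wprob_weight.
- move=> s ps; rewrite lt_neqAle wprob_ge0 andbT eq_sym; apply/eqP => qs.
  have [s0|s0] := posnP (size s).
    have [q1 _ _ _] := wprob_weight invQ.
    by move: qs; rewrite (size0nil s0) q1 => /eqP; rewrite oner_eq0.
  have := ac _ s0 [set in_tuple s]%SET; rewrite !big_set1 !word_probE /= => /(_ qs).
  by move=> p0; rewrite p0 ltxx in ps.
- exact: C1.
- exact: cvg_sublinear.
- exact: cvg_sublinear.
- move=> u x v u0 xu v0.
  have := ud _ _ u0 v0 (in_tuple u) (in_tuple v) (Tuple (introT eqP xu)).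
  by rewrite !word_probE /= mulrA.
- move=> u v u0 v0.
  have [l [x [lt px qx]]] := sld _ _ u0 v0 (in_tuple u) (in_tuple v).
  exists x; rewrite size_tuple lt.
  by move: px qx; rewrite !word_probE /= -!mulrA.
Qed.

End admissible_pairs.

Section log_probabilities.
Context {R : realType} {A : finPointedType}.
Context {P Q : probability (full_shift A) R}.
Local Notation p := (wprob P).
Local Notation q := (wprob Q).
Local Notation info := (@info R A q).
Context (pq : forall s, 0 < p s -> 0 < q s).
Local Open Scope ereal_scope.

Lemma log_probE n (x : full_shift A) : (0 < n)%N ->
  log_prob Q n x = if (0 < q (mkseq x n))%R then (n%:R^-1 * info (mkseq x n))%R%:E
                   else +oo.
Proof.
move=> n0; rewrite /log_prob word_probE val_prefix.
case: ltP => [q0|q0].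
  by rewrite lne_EFin// -EFinM -EFinN /info mulrN.
rewrite le0_lneNy ?lee_fin// gt0_muleNy ?oppeNy ?oppeK//.
by rewrite lte_fin invr_gt0 ltr0n.
Qed.

Lemma measurable_log_prob n : (0 < n)%N -> measurable_fun [set: full_shift A] (log_prob Q n).
Proof.
move=> n0 _ Y mY; rewrite setTI.
pose g s : \bar R := if (0 < q s)%R then (n%:R^-1 * info s)%R%:E else +oo.
rewrite (_ : _ @^-1` Y = [set x : full_shift A | Y (g (mkseq x n))]).
  exact: (measurable_prefix n (fun s => Y (g s))).
by apply/seteqP; split=> x; rewrite /preimage /= log_probE.
Qed.

Lemma log_prob_fin n : (0 < n)%N -> {ae P, forall x, log_prob Q n x \is a fin_num}.
Proof.
move=> n0; exists [set x : full_shift A | ~ (0 < q (mkseq x n))%R]; split.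
- exact: (measurable_prefix n (fun s => ~ (0 < q s)%R)).
- rewrite (prefix_prob P n (fun s => ~ (0 < q s)%R)) big1// => s /asboolP qs.
  apply/eqP; rewrite eq_le wprob_ge0 andbT leNgt; apply/negP => /pq; exact: qs.
- move=> x /= nx qx; apply: nx; by rewrite log_probE// qx.
Qed.

(** Words of positive [p]-weight have positive [q]-weight, so that the
    infinite values of [log_prob] do not matter. *)
Lemma log_prob_event n (S : set R) : (0 < n)%N ->
  P (log_prob Q n @^-1` (EFin @` S)) = (@event_mass R A p q n S)%:E.
Proof.
move=> n0.
rewrite (_ : _ @^-1` _ = [set x : full_shift A | (0 < q (mkseq x n))%R /\
    S (n%:R^-1 * info (mkseq x n))%R]); last first.
  apply/seteqP; split=> x; rewrite /preimage /= log_probE//.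
    by case: ltP => [q0 [y Sy [<-]]|_ [y _]].
  by move=> [-> Sx]; exists (n%:R^-1 * info (mkseq x n))%R.
rewrite (prefix_prob P n (fun s => (0 < q s)%R /\ S (n%:R^-1 * info s)%R)).
congr EFin; rewrite /event_mass big_mkcond [RHS]big_mkcond; apply: eq_bigr => s _ /=.
have := wprob_ge0 P s; rewrite le_eqVlt => /predU1P[<-|ps].
  by rewrite ltxx/=; case: ifP.
rewrite ps /=; congr (if _ then _ else _).
by apply: asbool_equiv_eq; split=> [[]//|]; split => //; exact: pq.
Qed.

End log_probabilities.

Section large_deviations.
Context {R : realType} {A : finPointedType}.
Context {P Q : probability (full_shift A) R} {c : nat} {e : nat -> nat}.
Local Notation p := (wprob P).
Local Notation q := (wprob Q).
Local Notation info := (@info R A q).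
Context (glued : glued_words c e p q).
Local Notation rate := (@rate R A p q).
Local Notation rate_le := (@rate_le R A p q).
Local Notation event_mass := (@event_mass R A p q).
Local Open Scope ereal_scope.

Let pq := glued_gt0 glued.

Let event_ge0 n S : (0 <= event_mass n S)%R.
Proof. by apply: sumr_ge0 => s _; exact: wprob_ge0. Qed.

Lemma ldp_rate : ldp P (log_prob Q) rate.
Proof.
split.
- move=> n n0; split; [exact: measurable_log_prob|exact: log_prob_fin].
- by split; [exact: (rate_ge0 glued)|exact: (rate_lsc glued)].
- move=> O oO; apply: limn_einf_ge => l.
  rewrite lteNr => /ereal_inf_lt[_ [x Ox <-]].
  case E : (rate x) (rate_ge0 glued x) => [r| |] //= _.
  rewrite lte_fin => rl.
  have Hx : rate_le x r by apply/(rate_leP glued); rewrite E.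
  have eps0 : (0 < - l - r)%R by lra.
  have [N0 _ HN] := event_open oO Ox Hx eps0.
  exists N0.+1 => // N /= N0N; have := HN N (ltnW N0N) => /= {}HN.
  have N1 : (0 < N)%N by exact: leq_trans N0N.
  have ev0 : (0 < event_mass N O)%R by apply: lt_le_trans HN; exact: expR_gt0.
  rewrite log_prob_event// lne_EFin// -EFinM lee_fin.
  rewrite ler_pdivlMl ?ltr0n// -ler_expR lnK//.
  by apply: le_trans HN; rewrite ler_expR addrC subrK mulrN opprK.
- move=> F cF; apply: limn_esup_le => l.
  rewrite lteNl -EFinN => lc.
  have trivial_bound : (0 <= l)%R -> \forall n \near \oo,
      n%:R^-1%:E * lne (P (log_prob Q n @^-1` (EFin @` F))) <= l%:E.
    move=> l0; exists 1%N => // n /= n0.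
    apply: (@le_trans _ _ 0); last by rewrite lee_fin.
    rewrite mule_ge0_le0 ?lee_fin ?invr_ge0// lne_le0.
    by rewrite log_prob_event// lee_fin (event_le1 glued).
  have [|l0] := leP 0%R l; first exact: trivial_bound.
  have [K lK Kc] : exists2 K, (- l < K)%R & K%:E <= ereal_inf (rate @` F).
    case E : (ereal_inf _) lc => [i| |] //=.
      by rewrite lte_fin => li; exists i.
    by move=> _; exists (1 - l)%R; rewrite ?leey//; lra.
  pose K' := ((K - l) / 2)%R.
  have K'0 : (0 < K')%R by rewrite /K'; lra.
  have nF x : F x -> ~ rate_le x K'.
    move=> Fx /(rate_leP glued) xK; have := le_trans Kc (ereal_inf_lbound (imageP rate Fx)).
    by move=> /le_trans/(_ xK); rewrite lee_fin /K'; lra.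
  have eps0 : (0 < (K' + l) / 2)%R by rewrite /K'; lra.
  have [N0 _ HN] := event_closed glued cF K'0 nF eps0.
  near=> N.
  have N1 : (0 < N)%N by near: N; exact: nbhs_infty_gt.
  have N1r : (0 < N%:R :> R)%R by rewrite ltr0n.
  have N0N : (N0 <= N)%N by near: N; exact: nbhs_infty_ge.
  have ln2N : (ln 2 <= (K' + l) / 2 * N%:R)%R.
    by rewrite -ler_pdivrMl//; near: N; exact: nbhs_infty_ger.
  rewrite log_prob_event//.
  have := event_ge0 N F; rewrite le_eqVlt => /predU1P[<-|ev0].
    by rewrite le0_lneNy// gt0_muleNy ?leNye// lte_fin invr_gt0.
  rewrite lne_EFin// -EFinM lee_fin ler_pdivrMl// -ler_expR lnK//.
  have /= := HN N N0N; move=> /le_trans; apply.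
  rewrite -{1}[2%R](@lnK R) ?posrE// -expRD ler_expR.
  by move: ln2N; lra.
Unshelve. all: by end_near. Qed.

End large_deviations.

Section pressure.
Context {R : realType} {A : finPointedType}.
Context {P Q : probability (full_shift A) R} {c : nat} {e : nat -> nat}.
Local Notation p := (wprob P).
Local Notation q := (wprob Q).
Context (glued : glued_words c e p q).
Local Notation rate := (@rate R A p q).
Local Open Scope ereal_scope.

Lemma pressure_seqE al n :
  pressure_seq P Q al n = (n%:R^-1 * ln (@partition_sum R A p q al n))%:E.
Proof.
rewrite /pressure_seq (_ : \sum_(u in _) _ = @partition_sum R A p q al n)%R.
  by rewrite lne_EFin ?(partition_sum_gt0 glued)// -EFinM.
rewrite /partition_sum -[RHS]big_tuple_words; apply: eq_big => u.
  by rewrite inE word_probE.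
rewrite inE !word_probE => pu; congr (_ * _)%R.
have qu := glued_gt0 glued pu.
by rewrite /powR gt_eqF// /info mulNr mulrN.
Qed.

Lemma pressure_cvg al : pressure_seq P Q al @ \oo --> legendre rate al.
Proof.
rewrite (_ : pressure_seq P Q al = fun n =>
  (n%:R^-1 * ln (@partition_sum R A p q al n))%:E); first exact: (partition_sum_cvg glued).
by apply/funext => n; exact: pressure_seqE.
Qed.

Lemma pressureE : pressure P Q = legendre rate.
Proof. by apply/funext => al; apply: cvg_lim => //; exact: pressure_cvg. Qed.

Lemma rate_pressure s : rate s = legendre (pressure P Q) s.
Proof.
rewrite pressureE; apply: legendreK.
- exact: (rate_ge0 glued).
- exact: (rate_lsc glued).
- exact: (rate_convex glued).
Qed.

End pressure.

(** * Information of a measure on its own words *)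

Section self_information_measure.
Context {R : realType} {A : finPointedType}.
Context {P : probability (full_shift A) R} {c : nat} {e : nat -> nat}.
Local Notation p := (wprob P).
Local Notation info := (@info R A p).
Context (glued : glued_words c e p p).
Local Notation rate := (@rate R A p p).
Local Notation rate_le := (@rate_le R A p p).
Local Notation partition_sum := (@partition_sum R A p p).
Local Open Scope ereal_scope.
Implicit Types (w : seq A) (s r : R).

Let exists_tuple n : exists u : n.-tuple A, (0 < p u)%R.
Proof.
apply: contrapT => ns; have := partition_sum_gt0 glued 0 n.
rewrite /partition_sum -big_tuple_words big_pred0 ?ltxx// => u.
by apply/negP => pu; apply: ns; exists u.
Qed.

Let info_le (u v : seq A) : (0 < p u)%R -> (0 < p v)%R ->
  (info u <= info v)%R = (p v <= p u)%R.
Proof. by move=> pu pv; rewrite /info lerN2 ler_ln. Qed.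

Lemma gamma_plus_word n : (0 < n)%N -> exists w, [/\ size w = n, (0 < p w)%R,
    gamma_plus_seq P n = (- (n%:R^-1 * info w))%:E &
    forall v, size v = n -> (0 < p v)%R -> (info w <= info v)%R].
Proof.
move=> n0; have [u0 pu0] := exists_tuple n.
have [u _ umax] := arg_maxP (P := predT) (i0 := u0) (fun u : n.-tuple A => p u) isT.
have pu : (0 < p u)%R by exact: lt_le_trans (umax u0 isT).
exists u; rewrite size_tuple; split => //; last first.
  move=> v vn pv; rewrite info_le//.
  exact: (umax (Tuple (introT eqP vn)) isT).
rewrite /gamma_plus_seq (_ : ereal_sup _ = (ln (p u))%:E); last first.
  apply/eqP; rewrite eq_le; apply/andP; split.
    apply: ge_ereal_sup => _ [v _ <-]; rewrite word_probE.
    have [pv|pv] := ltP 0%R (p v); last by rewrite le0_lneNy ?leNye// lee_fin.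
    by rewrite lne_EFin// lee_fin ler_ln//; exact: umax.
  by apply: ereal_sup_ubound; exists u; rewrite // word_probE lne_EFin.
by rewrite -EFinM /info mulrN opprK.
Qed.

Lemma gamma_minus_word n : (0 < n)%N -> exists w, [/\ size w = n, (0 < p w)%R,
    gamma_minus_seq P n = (- (n%:R^-1 * info w))%:E &
    forall v, size v = n -> (0 < p v)%R -> (info v <= info w)%R].
Proof.
move=> n0; have [u0 pu0] := exists_tuple n.
have [u /= pu umin] := arg_minP (P := [pred u : n.-tuple A | (0 < p u)%R])
  (i0 := u0) (fun u : n.-tuple A => p u) pu0.
exists u; rewrite size_tuple; split => //; last first.
  move=> v vn pv; rewrite info_le//.
  exact: (umin (Tuple (introT eqP vn)) pv).
rewrite /gamma_minus_seq (_ : ereal_inf _ = (ln (p u))%:E); last first.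
  apply/eqP; rewrite eq_le; apply/andP; split.
    apply: ereal_inf_lbound; exists u; last by rewrite word_probE lne_EFin.
    by rewrite /= inE word_probE.
  apply: le_ereal_inf_tmp => _ [v vs <-].
  have pv : (0 < p v)%R by move: vs; rewrite /= inE word_probE.
  by rewrite word_probE lne_EFin// lee_fin ler_ln//; exact: umin.
by rewrite -EFinM /info mulrN opprK.
Qed.

(** At both ends of the range there are words with [info] per letter close to
    the given value; [rate_le_self] interpolates between them. *)
Lemma rate_le_range s : - gamma_plus P <= s%:E <= - gamma_minus P -> rate_le s s.
Proof.
move=> /andP[s1 s2]; apply: (rate_le_self glued) => eps e0 n0.
  have : (- (s + eps))%:E < gamma_plus P.
    by rewrite EFinN lteNl (le_lt_trans s1)// lte_fin ltrDl.
  move=> /limn_esup_gt/(_ (maxn 1 n0))[n].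
  rewrite geq_max => /andP[n1 n0n]; have [w [wn pw -> _]] := gamma_plus_word n1.
  rewrite lte_fin ltrN2 => /ltW h; exists w; rewrite wn; split => //.
  by move: h; rewrite ler_pdivrMl ?ltr0n.
have : gamma_minus P < (- (s - eps))%:E.
  by rewrite EFinN lteNr (lt_le_trans _ s2)// lte_fin gtrBl.
move=> /limn_einf_lt/(_ (maxn 1 n0))[n].
rewrite geq_max => /andP[n1 n0n]; have [w [wn pw -> _]] := gamma_minus_word n1.
rewrite lte_fin ltrN2 => /ltW h; exists w; rewrite wn; split => //.
by move: h; rewrite ler_pdivlMl ?ltr0n.
Qed.

Lemma range_rate_le s r : rate_le s r -> - gamma_plus P <= s%:E <= - gamma_minus P.
Proof.
move=> Hs; apply/andP; split.
  rewrite leeNl -EFinN; apply: lee_reals => l; rewrite lte_fin => ls.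
  rewrite leNgt; apply/negP => /limn_esup_lt[N0 _ HN0].
  have eps0 : (0 < (- s - l) / 2)%R by lra.
  have [N1 _ HN1] := rate_le_word Hs eps0.
  pose N := (maxn 1 (maxn N0 N1)).
  have [n1 n2 n3] : [/\ (0 < N)%N, (N0 <= N)%N & (N1 <= N)%N].
    by rewrite /N; split; clear; lia.
  have [w [_ _ gw wmin]] := gamma_plus_word n1.
  have := HN0 N n2; rewrite /= gw lee_fin lerNl.
  have [v [vn pv /andP[_ iv]]] := HN1 N n3.
  have Nr : (0 < N%:R :> R)%R by rewrite ltr0n.
  rewrite ler_pdivlMl// => h; have h2 := wmin v vn pv.
  have := le_trans h (le_trans h2 iv); rewrite ler_pM2l//; lra.
rewrite leeNr -EFinN; apply: lee_reals_up => l; rewrite lte_fin => ls.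
rewrite leNgt; apply/negP => /limn_einf_gt[N0 _ HN0].
have eps0 : (0 < (s + l) / 2)%R by lra.
have [N1 _ HN1] := rate_le_word Hs eps0.
pose N := (maxn 1 (maxn N0 N1)).
have [n1 n2 n3] : [/\ (0 < N)%N, (N0 <= N)%N & (N1 <= N)%N].
  by rewrite /N; split; clear; lia.
have [w [_ _ gw wmax]] := gamma_minus_word n1.
have := HN0 N n2; rewrite /= gw lee_fin lerNr.
have [v [vn pv /andP[iv _]]] := HN1 N n3.
have Nr : (0 < N%:R :> R)%R by rewrite ltr0n.
rewrite ler_pdivrMl// => h; have h2 := wmax v vn pv.
have := le_trans (le_trans iv h2) h; rewrite ler_pM2l//; lra.
Qed.

Lemma rate_le_range_le : exists2 s, rate_le s 1 &
  gamma_minus P <= (- s)%:E <= gamma_plus P.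
Proof.
have [s Hs] := rate_le_small glued (@ltr01 R); exists s => //.
have /andP[h1 h2] := range_rate_le Hs.
by rewrite EFinN; apply/andP; split; [rewrite leeNr|rewrite leeNl].
Qed.

(** The rate is finite at [- gamma_plus P], hence near-optimal words exist at
    every large length and not only along a subsequence. *)
Lemma gamma_plus_cvg : gamma_plus_seq P @ \oo --> gamma_plus P.
Proof.
apply: (cvg_limn_esup _).1; apply: limn_einf_ge => l lg.
have [s1 _ /andP[g1 g2]] := rate_le_range_le.
(* [s1] rules out that [gamma_plus P] is [-oo] *)
have [s ls /andP[gs1 gs2]] : exists2 s, (l < - s)%R &
    gamma_minus P <= (- s)%:E <= gamma_plus P.
  case E : (gamma_plus P) lg g2 => [g| |] //=; rewrite -/(gamma_plus P) E.
  - rewrite lte_fin lee_fin => lg s1g; exists (- g)%R; rewrite opprK// lexx andbT.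
    by rewrite (le_trans g1)// lee_fin.
  - move=> _ _; exists (- Num.max (l + 1) (- s1))%R; rewrite opprK.
      by rewrite lt_max ltrDl ltr01.
    by rewrite leey andbT (le_trans g1)// lee_fin le_max lexx orbT.
have Hs : rate_le s s.
  by apply: rate_le_range; apply/andP; split; [rewrite leeNl -EFinN|rewrite leeNr -EFinN].
have eps0 : (0 < - s - l)%R by lra.
have [N0 _ HN0] := rate_le_word Hs eps0.
exists N0.+1 => // N /= N0N.
have N1 : (0 < N)%N by exact: leq_ltn_trans N0N.
have [w [_ _ -> wmin]] := gamma_plus_word N1.
have [v [vn pv /andP[_ iv]]] := HN0 N (ltnW N0N).
rewrite lee_fin lerNr ler_pdivrMl ?ltr0n//.
apply: (le_trans (wmin v vn pv)); apply: (le_trans iv).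
by rewrite ler_wpM2l//; lra.
Qed.

(** If [gamma_minus P] is infinite there is no optimal value, and finite
    values [- s] below the prescribed level [l] are used instead. *)
Lemma gamma_minus_cvg : gamma_minus_seq P @ \oo --> gamma_minus P.
Proof.
apply: (cvg_limn_esup _).2; apply: limn_esup_le => l lg.
have [s1 _ /andP[g1 g2]] := rate_le_range_le.
have [s ls /andP[gs1 gs2]] : exists2 s, (- s < l)%R &
    gamma_minus P <= (- s)%:E <= gamma_plus P.
  have [s1l|ls1] := ltP (- s1)%R l; first by exists s1; rewrite ?g1.
  case E : (gamma_minus P) lg g1 => [g| |] //=; rewrite -/(gamma_minus P) E.
  - rewrite lte_fin lee_fin => gl gs1; exists (- g)%R; rewrite opprK// lexx /=.
    by rewrite (le_trans _ g2)// lee_fin.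
  - move=> _ _; exists (- (l - 1))%R; rewrite opprK ?gtrBl// leNye /=.
    by rewrite (le_trans _ g2)// lee_fin; lra.
have Hs : rate_le s s.
  by apply: rate_le_range; apply/andP; split; [rewrite leeNl -EFinN|rewrite leeNr -EFinN].
have eps0 : (0 < l + s)%R by lra.
have [N0 _ HN0] := rate_le_word Hs eps0.
exists N0.+1 => // N /= N0N.
have N1 : (0 < N)%N by exact: leq_ltn_trans N0N.
have [w [_ _ -> wmax]] := gamma_minus_word N1.
have [v [vn pv /andP[iv _]]] := HN0 N (ltnW N0N).
rewrite lee_fin lerNl ler_pdivlMl ?ltr0n//.
apply: (le_trans _ (wmax v vn pv)); apply: (le_trans _ iv).
by rewrite ler_wpM2l//; lra.
Qed.

Lemma partition_sum1 n : partition_sum 1 n = #|word_supp P n|%:R.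
Proof.
rewrite /partition_sum -big_tuple_words -sum1_card natr_sum; apply: eq_big => u.
  by rewrite inE word_probE.
by move=> pu; rewrite mul1r /info expRN lnK// mulVf// gt_eqF.
Qed.

(** At [al = 1] the partition sum of [p] against itself counts the words of
    positive weight. *)
Lemma legendre_rate_htop : legendre rate 1%R = (htop_supp P)%:E.
Proof.
have cv := @partition_sum_cvg _ _ _ _ _ _ glued 1%R.
have hN := legendre_gtNy 1%R (rate_fin glued).
have hy : legendre rate 1%R <= (ln #|A|%:R)%:E.
  rewrite -(cvg_lim _ cv)//; apply: lime_le; first by apply/cvg_ex; exists (legendre rate 1%R).
  exists 1%N => // n /= n0; rewrite lee_fin ler_pdivrMl ?ltr0n//.
  rewrite partition_sum1.
  have c0 : (0 < #|A|)%N by apply/card_gt0P; exists point.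
  rewrite mulr_natl -lnXn ?ltr0n// ler_ln ?posrE ?exprn_gt0 ?ltr0n//.
    by rewrite -natrX ler_nat -card_tuple max_card.
  by rewrite -(ltr0n R) -partition_sum1; exact: (partition_sum_gt0 glued).
case E : (legendre rate 1%R) hN hy => [h| |] // _ _.
move: cv; rewrite E => /fine_cvgP[_ cv].
congr EFin; apply/esym/cvg_lim => //.
move: cv; apply: cvg_trans; apply: near_eq_cvg; apply: nearW => n /=.
by rewrite partition_sum1.
Qed.

End self_information_measure.

Section self_information_rate.
Context {R : realType} {A : finPointedType}.
Context {P : probability (full_shift A) R} {c : nat} {e : nat -> nat}.
Local Notation p := (wprob P).
Local Notation info := (@info R A p).
Context (glued : glued_words c e p p).
Local Notation rate := (@rate R A p p).
Local Notation rate_le := (@rate_le R A p p).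
Local Open Scope ereal_scope.
Implicit Types (w : seq A) (s r : R).

Lemma size_words n : size (@words A n) = (#|A| ^ n)%N.
Proof.
by elim: n => //= n IH; rewrite size_allpairs IH -cardE expnS.
Qed.

(** There are [#|A| ^ n] words, and those with [info] larger than [n * M]
    have probability at most [exp (- n * M)] each. *)
Lemma exponentially_tight_log_prob : exponentially_tight P (log_prob P).
Proof.
move=> beta; have c0 : (0 < #|A|)%N by apply/card_gt0P; exists point.
have c0r : (0 < #|A|%:R :> R)%R by rewrite ltr0n.
have lnA : (0 <= ln #|A|%:R :> R)%R by rewrite ln_ge0// ler1n.
pose M := (`|beta| + ln #|A|%:R + 1)%R.
have M0 : (0 < M)%R by rewrite /M ltr_wpDl// addr_ge0.
exists M => //; exists 1%N => // n /= n0.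
have nr : (0 < n%:R :> R)%R by rewrite ltr0n.
pose B w := ~ ((0 < p w)%R /\ (info w <= n%:R * M)%R).
rewrite (_ : [set x | _] = [set x | B (mkseq x n)]); last first.
  apply/seteqP; split=> x /=; rewrite log_probE// /B.
    move=> nx [px ix]; apply: nx; rewrite px !lee_fin ler_pdivrMl// ix andbT.
    rewrite (@le_trans _ _ 0%R) ?oppr_le0 ?(ltW M0)//.
    by rewrite mulr_ge0 ?invr_ge0// (info_ge0 glued).
  move=> nB; case: ltP => [px|_]; last by rewrite leye_eq andbF.
  rewrite !lee_fin => /andP[_ ix]; apply: nB; split => //.
  by move: ix; rewrite ler_pdivrMl.
rewrite (prefix_prob P n B) lee_fin.
apply: (@le_trans _ _ (\sum_(s <- @words A n) expR (- (n%:R * M)))%R).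
  rewrite big_mkcond; apply: ler_sum => s _.
  case: asboolP => [Bs|_]; last exact: expR_ge0.
  have [ps|ps] := ltP 0%R (p s); last exact: le_trans ps (expR_ge0 _).
  rewrite -[leLHS]lnK ?posrE// ler_expR lerNr.
  rewrite leNgt; apply/negP => h; apply: Bs; split => //; exact: ltW.
rewrite big_const_seq count_predT size_words iter_addr_0 -[leLHS]mulr_natl natrX.
rewrite -[X in (X ^+ n)%R](@lnK R)// -expRM_natl -expRD ler_expR.
have : (n%:R * beta <= n%:R * `|beta|)%R by rewrite ler_wpM2l// ler_norm.
by rewrite /M; lra.
Qed.

Lemma rate_ge_htop s : (s - htop_supp P)%R%:E <= rate s.
Proof.
case E : (rate s) (rate_ge0 glued s) => [r| |] //= _; last by rewrite leey.
have : (1 * s - r)%R%:E <= legendre rate 1 by apply: legendre_ge; rewrite E.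
by rewrite (legendre_rate_htop glued) !lee_fin; lra.
Qed.

Lemma good_rate : good rate.
Proof.
split.
  apply/cvgeyPge => M; near=> s; apply: le_trans (rate_ge_htop s).
  rewrite lee_fin lerBrDr; by near: s; apply: nbhs_pinfty_ge; rewrite num_real.
apply/cvgeyPge => M; near=> s.
rewrite (rate_lt0 glued) ?leey//; near: s; apply: nbhs_ninfty_lt; rewrite num_real.
Unshelve. all: by end_near. Qed.

(** The rate is finite exactly between [- gamma_plus P] and [- gamma_minus
    P], and lies below the identity there: a bounded range makes the
    transform finite, an unbounded one makes it infinite at every slope
    larger than 1. *)
Lemma pressure_dichotomy :
  (-oo < gamma_minus P /\ forall al : R, legendre rate al < +oo) \/
  (gamma_minus P = -oo /\ forall al : R, (1 < al)%R -> legendre rate al = +oo).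
Proof.
have [s1 _ /andP[g1 g2]] := rate_le_range_le glued.
case E : (gamma_minus P) g1 => [g| |] // g1.
  left; split => [|al]; first by rewrite ltNyr.
  have : legendre rate al <= (`|al| * `|g|)%:E.
    apply: legendre_le; first exact: (rate_ge0 glued).
    move=> s r /(rate_leP glued) Hs; have [s0 r0] := rate_le_ge0 glued Hs.
    have /andP[_] := range_rate_le glued Hs; rewrite E lee_fin => sg.
    apply: (@le_trans _ _ (`|al| * s)%R).
      have : (al * s <= `|al| * s)%R by rewrite ler_wpM2r// ler_norm.
      by lra.
    by rewrite ler_wpM2l// (le_trans sg)// -normrN ler_norm.
  by move=> /le_lt_trans; apply; rewrite ltry.
right; split => // al al1; apply/eqP; rewrite -leye_eq; apply: lee_reals => M _.
pose s := Num.max s1 (`|M| / (al - 1))%R.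
have Hs : rate_le s s.
  apply: (rate_le_range glued); rewrite E /= leey andbT leeNl.
  by rewrite (le_trans _ g2)// EFinN leeN2 lee_fin le_max lexx.
have := @legendre_ge _ _ al s s ((rate_leP glued s s).2 Hs).
apply: le_trans; rewrite lee_fin.
have : (`|M| <= (al - 1) * s)%R.
  by rewrite mulrC -ler_pdivrMr ?subr_gt0// le_max lexx orbT.
by have := ler_norm M; lra.
Qed.

End self_information_rate.

Local Open Scope ereal_scope.

Theorem theorem0 (R : realType) (A : finPointedType)
    (P Q : probability (full_shift A) R) (tau : nat -> nat) (C : nat -> R) :
  decoupling_rates tau C ->
  shift_invariant P -> shift_invariant Q ->
  admissible tau C P Q ->
  exists I : R -> \bar R,
    [/\ (* (i) *)
        [/\ ldp P (log_prob Q) I,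
            ereal_convex I &
            forall s : R, (s < 0)%R -> I s = +oo],
        (* (ii) *)
        [/\ forall alpha : R,
              cvgn (pressure_seq P Q alpha) /\ -oo < pressure P Q alpha,
            [/\ {homo pressure P Q : a b / (a <= b)%R >-> a <= b},
                ereal_convex (pressure P Q),
                lower_semicontinuous (pressure P Q) &
                pressure P Q 0%R = 0],
            forall alpha : R, pressure P Q alpha = legendre I alpha &
            forall s : R, I s = legendre (pressure P Q) s] &
        (* (iii) *)
        Q = P ->
        [/\ (* (a) *)
            [/\ exponentially_tight P (log_prob P),
                good I,
                forall s : R, - gamma_plus P <= s%:E <= - gamma_minus P ->
                  (s - htop_supp P)%R%:E <= I s <= s%:E &
                forall s : R, ~ (- gamma_plus P <= s%:E <= - gamma_minus P) ->
                  I s = +oo],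
            (* (b) *)
            gamma_plus_seq P @ \oo --> gamma_plus P /\
            gamma_minus_seq P @ \oo --> gamma_minus P,
            (* (c) *)
            (forall alpha : R, (alpha <= 1)%R ->
               pressure P P alpha <= pressure P P 1%R) /\
            pressure P P 1%R = (htop_supp P)%:E &
            (* (d) *)
            (-oo < gamma_minus P /\
               forall alpha : R, pressure P P alpha < +oo) \/
            (gamma_minus P = -oo /\
               forall alpha : R, (1 < alpha)%R -> pressure P P alpha = +oo)]].
Proof.
move=> rates invP invQ adm.
have [c [e glued]] := decoupled_glued (admissible_decoupled rates invP invQ adm).
have I0 := rate_ge0 glued; have Ifin := rate_fin glued; have Ineg := rate_lt0 glued.
exists (@rate R A (wprob P) (wprob Q)); split.
- by split; [exact: ldp_rate glued|exact: (rate_convex glued)|].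
- rewrite (pressureE glued); split => //.
  + move=> al; split; last exact: legendre_gtNy.
    by apply/cvg_ex; eexists; exact: (pressure_cvg glued).
  + split; [exact: legendre_homo|exact: legendre_convex|exact: legendre_lsc|].
    exact: (legendre_rate0 glued).
  + by move=> s; rewrite -(pressureE glued); exact: (rate_pressure glued).
move=> QP; subst Q; rewrite (pressureE glued); split.
- split.
  + exact: (exponentially_tight_log_prob glued).
  + exact: (good_rate glued).
  + move=> s /(rate_le_range glued)/(rate_leP glued) ->.
    by rewrite (rate_ge_htop glued).
  + move=> s ns; case E : (rate s) (I0 s) => [r| |] //= _.
    exfalso; apply: ns; apply: (range_rate_le glued (r := r)).
    by apply/(rate_leP glued); rewrite E.
- by split; [exact: (gamma_plus_cvg glued)|exact: (gamma_minus_cvg glued)].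
- split; last exact: (legendre_rate_htop glued).
  by move=> al al1; apply: legendre_homo.
- exact: (pressure_dichotomy glued).
Qed.
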